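(* Let $F$ be an algebraically closed field of characteristic different from $2$ and let $\mathbf{O}$ be the octonion algebra over $F$. The module $S^2(\mathbf{O})$, subject to the twisted action of $SO(7)$ given by $g\cdot v=\rho(g)v$ for $g\in SO(7)$, $v\in S^2(\mathbf{O})$ (where $\rho$ is the triality automorphism of $PSO(8)$ described in the context), is isomorphic to $\Lambda^0(\mathbf{O}_0)\oplus\Lambda^3(\mathbf{O}_0)$, where $\mathbf{O}_0$ is the natural $SO(7)$-module of traceless octonions.
   Context: $\mathbf{O}$ is the Zorn vector-matrix algebra over $F$, consisting of all $a=\begin{pmatrix}\alpha&\mathbf{u}\\ \mathbf{v}&\beta\end{pmatrix}$ with $\alpha,\beta\in F$, $\mathbf{u},\mathbf{v}\in F^3$, and multiplication $$\begin{pmatrix}\alpha&\mathbf{u}\\ \mathbf{v}&\beta\end{pmatrix}\begin{pmatrix}\alpha'&\mathbf{u}'\\ \mathbf{v}'&\beta'\end{pmatrix}=\begin{pmatrix}\alpha\alpha'+\mathbf{u}\cdot\mathbf{v}'&\alpha\mathbf{u}'+\beta'\mathbf{u}-\mathbf{v}\times\mathbf{v}'\\ \alpha'\mathbf{v}+\beta\mathbf{v}'+\mathbf{u}\times\mathbf{u}'&\beta\beta'+\mathbf{v}\cdot\mathbf{u}'\end{pmatrix}.$$ Norm $n(a)=\alpha\beta-\mathbf{u}\cdot\mathbf{v}$ with associated bilinear form $q$; trace $t(a)=\alpha+\beta$; $\mathbf{O}_0=\{a:t(a)=0\}$, the orthogonal complement of $1_{\mathbf{O}}$; $\mathbf{O}_1=\{a: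 n(a)=1\}$. $SO(8)=SO(\mathbf{O},q)$ is generated by $L_x:z\mapsto xz$ and $R_x:z\mapsto zx$ for $x\in\mathbf{O}_1$; $PSO(8)=SO(8)/\{\pm E\}$. For $x\in M=\mathbf{O}_1/\{\pm1_{\mathbf{O}}\}$ write $L_x,R_x$ also for the induced elements of $PSO(8)$, and put $P_x=L_x^{-1}R_x^{-1}$. The triality automorphism $\rho$ of $PSO(8)$ is the automorphism of order $3$ determined by $R_x^\rho=P_x$, $L_x^\rho=R_x$, $P_x^\rho=L_x$ for all $x\in M$. $SO(7)=\mathrm{Stab}_{SO(8)}(1_{\mathbf{O}})$ is identified with its image in $PSO(8)$. Since $-E$ acts trivially on $\mathbf{O}^{\otimes2}$, $S^2(\mathbf{O})$ is a $PSO(8)$-module, so $\rho(g)v$ makes sense. *)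

(* Defs.v *)
From HB Require Import structures.
From mathcomp Require Import all_boot all_order all_algebra.
From mathcomp Require Import perm generic_quotient ring_quotient.
From mathcomp Require Import boolp.
From mathcomp Require Import ring.

Set Implicit Arguments.
Unset Strict Implicit.
Unset Printing Implicit Defensive.

Import GRing.Theory passmx.
Import Quotient.
Local Open Scope ring_scope.
Local Open Scope quotient_scope.

Section QuotientSpace.
Variables (F : fieldType) (V : vectType F) (S : V -> Prop).

(* The span of S, as the intersection of all subspaces containing S. *)
Definition spanned : {pred V} :=
  [pred t | `[< forall U : {vspace V}, (forall s, S s -> s \in U) -> t \in U >]].

Lemma spannedP t :
  reflect (forall U : {vspace V}, (forall s, S s -> s \in U) -> t \in U)
          (t \in spanned).
Proof. exact: asboolP. Qed.

Lemma mem_spanned s : S s -> s \in spanned.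
Proof. by move=> Ss; apply/spannedP => U; apply. Qed.

Lemma spanned_submod_closed : submod_closed spanned.
Proof.
split=> [|a u v /spannedP su /spannedP sv]; apply/spannedP => U SU.
  exact: mem0v.
by rewrite rpredD ?rpredZ ?su ?sv.
Qed.

HB.instance Definition _ :=
  GRing.isSubmodClosed.Build F V spanned spanned_submod_closed.

Definition qspace := {quot spanned}.

HB.instance Definition _ := GRing.Zmodule.on qspace.
HB.instance Definition _ := EqQuotient.on qspace.
HB.instance Definition _ := @isZmodQuotient.Build V (equiv spanned)
  0 -%R +%R qspace (lock _) (@pi_opp _ spanned) (@pi_add _ spanned).

Lemma qspace_eq (t s : V) : (\pi_qspace t == \pi_qspace s) = (t - s \in spanned).
Proof. by rewrite idealrBE. Qed.

Definition qscale (a : F) (x : qspace) : qspace := \pi_qspace (a *: repr x).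

Lemma qscale_pi a t : qscale a (\pi_qspace t) = \pi_qspace (a *: t).
Proof.
apply/eqP; rewrite qspace_eq -scalerBr.
by apply: rpredZ; rewrite -qspace_eq reprK.
Qed.

Lemma qscaleA a b x : qscale a (qscale b x) = qscale (a * b) x.
Proof. by elim/quotW: x => t; rewrite (qscale_pi b t) !qscale_pi scalerA. Qed.
Lemma qscale1 : left_id 1 qscale.
Proof. by elim/quotW=> t; rewrite qscale_pi scale1r. Qed.
Lemma qscaleDr : right_distributive qscale +%R.
Proof.
move=> a; elim/quotW=> x; elim/quotW=> y.
by rewrite -raddfD !qscale_pi -raddfD scalerDr.
Qed.
Lemma qscaleDl x : {morph qscale^~ x : a b / a + b}.
Proof.
by elim/quotW: x => x a b /=; rewrite !qscale_pi -raddfD scalerDl.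
Qed.

HB.instance Definition _ := GRing.Zmodule_isLmodule.Build F qspace
  qscaleA qscale1 qscaleDr qscaleDl.

Lemma qpi_linear : linear \pi_qspace.
Proof.
by move=> a x y; rewrite raddfD; congr (_ + _); apply/esym/qscale_pi.
Qed.

End QuotientSpace.

(* The k-th tensor power of V, by coordinates in the basis of the             *)
(* e_(i 0) (x) ... (x) e_(i k.-1), where e = vbasis {:V}.                     *)
Definition tpow (F : fieldType) (k : nat) (V : vectType F) :=
  {ffun {ffun 'I_k -> 'I_(\dim {:V})} -> F^o}.
HB.instance Definition _ F k V := Vector.on (@tpow F k V).

Lemma tpowZE (F : fieldType) k (V : vectType F) a (t : tpow k V) i :
  (a *: t) i = a * t i.
Proof. exact: ffunE. Qed.

Section Powers.
Variables (F : fieldType) (k : nat).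
Implicit Types V W X : vectType F.

Definition tprod V (v : 'I_k -> V) : tpow k V :=
  [ffun i : {ffun 'I_k -> 'I_(\dim {:V})} => \prod_j coord (vbasis {:V}) (i j) (v j)].

(* The map v 0 (x) ... (x) v k.-1 |-> f (v 0) (x) ... (x) f (v k.-1).          *)
Definition tmap V W (f : 'Hom(V, W)) (t : tpow k V) : tpow k W :=
  \sum_i (t i : F) *: tprod (fun j => f (vbasis {:V})`_(i j)).

Definition sym_rel V (t : tpow k V) : Prop :=
  exists (v : 'I_k -> V) (s : 'S_k), t = tprod v - tprod (v \o s).

Definition alt_rel V (t : tpow k V) : Prop :=
  exists (v : 'I_k -> V) (i j : 'I_k), [/\ i != j, v i = v j & t = tprod v].

Definition sympow V := qspace (@sym_rel V).
Definition extpow V := qspace (@alt_rel V).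
HB.instance Definition _ V := GRing.Lmodule.on (sympow V).
HB.instance Definition _ V := GRing.Lmodule.on (extpow V).

Definition smap V W (f : 'Hom(V, W)) (x : sympow V) : sympow W :=
  \pi_(qspace (@sym_rel W)) (tmap f (repr (x : qspace _))).
Definition emap V W (f : 'Hom(V, W)) (x : extpow V) : extpow W :=
  \pi_(qspace (@alt_rel W)) (tmap f (repr (x : qspace _))).

Lemma tmapE V W (f : 'Hom(V, W)) (t : tpow k V) l :
  tmap f t l = \sum_i t i * tprod (fun j => f (vbasis {:V})`_(i j)) l.
Proof. by rewrite [LHS]sum_ffunE; apply: eq_bigr => i _; apply: ffunE. Qed.

Lemma tmap_linear V W (f : 'Hom(V, W)) : linear (tmap f).
Proof.
move=> a t s; rewrite /tmap scaler_sumr -big_split; apply: eq_bigr => i _ /=.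
by rewrite scalerA -scalerDl -tpowZE; congr (_ *: _); apply: ffunE.
Qed.

HB.instance Definition _ V W (f : 'Hom(V, W)) :=
  GRing.isLinear.Build F _ _ _ (tmap f) (tmap_linear f).

Lemma tmap_tprod V W (f : 'Hom(V, W)) (v : 'I_k -> V) :
  tmap f (tprod v) = tprod (f \o v).
Proof.
apply/ffunP => l; rewrite tmapE ffunE.
under [LHS]eq_bigr do rewrite !ffunE -big_split /=.
rewrite -(bigA_distr_bigA (fun j i => coord (vbasis {:V}) i (v j) *
  coord (vbasis {:W}) (l j) (f (vbasis {:V})`_i))).
apply: eq_bigr => j _; rewrite /= [in RHS](coord_vbasis (memvf (v j))).
by rewrite !linear_sum; apply: eq_bigr => i _; rewrite !linearZ.
Qed.

Lemma tmap_spanned V W (f : 'Hom(V, W)) (S : tpow k V -> Prop)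
    (S' : tpow k W -> Prop) :
  (forall t, S t -> S' (tmap f t)) ->
  forall t, t \in spanned S -> tmap f t \in spanned S'.
Proof.
move=> SS' t /spannedP st; apply/spannedP => U S'U.
have := st (linfun (tmap f) @^-1: U)%VS; rewrite -memv_preim lfunE; apply.
by move=> s /SS' /S'U; rewrite -memv_preim lfunE.
Qed.

Lemma smap_pi V W (f : 'Hom(V, W)) t :
  smap f (\pi_(qspace (@sym_rel V)) t) = \pi_(qspace (@sym_rel W)) (tmap f t).
Proof.
apply/eqP; rewrite qspace_eq -linearB; apply: (tmap_spanned (S := @sym_rel V)).
  move=> _ [v [s ->]]; exists (f \o v), s.
  by rewrite linearB /= !tmap_tprod.
by rewrite -qspace_eq reprK.
Qed.

Lemma emap_pi V W (f : 'Hom(V, W)) t :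
  emap f (\pi_(qspace (@alt_rel V)) t) = \pi_(qspace (@alt_rel W)) (tmap f t).
Proof.
apply/eqP; rewrite qspace_eq -linearB; apply: (tmap_spanned (S := @alt_rel V)).
  move=> _ [v [i [j [ij vij ->]]]]; exists (f \o v), i, j.
  by rewrite tmap_tprod /= vij.
by rewrite -qspace_eq reprK.
Qed.

Lemma tmapN V W (f : 'Hom(V, W)) t : tmap (- f) t = (-1) ^+ k *: tmap f t.
Proof.
apply/ffunP => l; rewrite tpowZE !tmapE mulr_sumr; apply: eq_bigr => i _.
rewrite mulrCA; congr (_ * _); rewrite !ffunE.
have -> : (-1) ^+ k = \prod_(j < k) (-1 : F) by rewrite prodr_const card_ord.
rewrite -big_split /=.
by apply: eq_bigr => j _; rewrite opp_lfunE linearN mulN1r.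
Qed.

Lemma tmap_comp V W X (g : 'Hom(W, X)) (f : 'Hom(V, W)) t :
  tmap (g \o f)%VF t = tmap g (tmap f t).
Proof.
rewrite [tmap f t]/tmap linear_sum; apply: eq_bigr => i _.
rewrite linearZ /= tmap_tprod; congr (_ *: _); apply/ffunP => l; rewrite !ffunE.
by apply: eq_bigr => j _; rewrite lfunE.
Qed.

Lemma tmap1 V t : tmap (\1 : 'End(V))%VF t = t.
Proof.
apply/ffunP => l; rewrite tmapE (bigD1 l) //= big1 ?addr0 => [|i il].
  rewrite ffunE big1 ?mulr1 // => j _.
  by rewrite lfunE coord_free ?eqxx // (basis_free (vbasisP _)).
have [j jP] : exists j, i j != l j.
  apply/existsP; rewrite -[X in is_true X]negbK negb_exists.
  by apply: contraNN il => /forallP h; apply/eqP/ffunP => j; apply/eqP/negbNE.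
rewrite ffunE (bigD1 j) //= lfunE coord_free ?(basis_free (vbasisP _)) //.
by rewrite eq_sym -val_eqE /= in jP *; rewrite (negPf jP) mul0r mulr0.
Qed.

Lemma smap_comp V W X (g : 'Hom(W, X)) (f : 'Hom(V, W)) x :
  smap (g \o f)%VF x = smap g (smap f x).
Proof. by elim/quotW: x => t; rewrite (smap_pi f t) !smap_pi tmap_comp. Qed.

Lemma emap_comp V W X (g : 'Hom(W, X)) (f : 'Hom(V, W)) x :
  emap (g \o f)%VF x = emap g (emap f x).
Proof. by elim/quotW: x => t; rewrite (emap_pi f t) !emap_pi tmap_comp. Qed.

End Powers.

Lemma smap2N (F : fieldType) (V W : vectType F) (f : 'Hom(V, W))
    (x : sympow 2 V) : smap (- f) x = smap f x.
Proof. by elim/quotW: x => t; rewrite !smap_pi tmapN expr2 mulrNN mulr1 scale1r. Qed.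

Section Octonions.
Variable F : fieldType.

(* (((alpha, u), v), beta) stands for the Zorn matrix [alpha u; v beta]. *)
Definition octonion := (F^o * 'rV[F]_3 * 'rV[F]_3 * F^o)%type.
HB.instance Definition _ := Vector.on octonion.

Definition mkoct (al : F) (u v : 'rV[F]_3) (be : F) : octonion := (al, u, v, be).
Definition oct_al (a : octonion) : F := a.1.1.1.
Definition oct_u (a : octonion) : 'rV[F]_3 := a.1.1.2.
Definition oct_v (a : octonion) : 'rV[F]_3 := a.1.2.
Definition oct_be (a : octonion) : F := a.2.

Definition dot3 (u v : 'rV[F]_3) : F := \sum_i u 0 i * v 0 i.
(* Indices in 'I_3 are added modulo 3. *)
Definition cross3 (u v : 'rV[F]_3) : 'rV[F]_3 :=
  \row_(i < 3) (u 0 (i + 1) * v 0 (i + 2%:R) - u 0 (i + 2%:R) * v 0 (i + 1)).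

Definition omul (a b : octonion) : octonion :=
  mkoct (oct_al a * oct_al b + dot3 (oct_u a) (oct_v b))
        (oct_al a *: oct_u b + oct_be b *: oct_u a - cross3 (oct_v a) (oct_v b))
        (oct_al b *: oct_v a + oct_be a *: oct_v b + cross3 (oct_u a) (oct_u b))
        (oct_be a * oct_be b + dot3 (oct_v a) (oct_u b)).

Definition oone : octonion := mkoct 1 0 0 1.
Definition onorm (a : octonion) : F :=
  oct_al a * oct_be a - dot3 (oct_u a) (oct_v a).
Definition opolar (a b : octonion) : F := onorm (a + b) - onorm a - onorm b.
Definition otr (a : octonion) : F := oct_al a + oct_be a.

Definition omulr (b a : octonion) : octonion := omul a b.

Lemma octP (a b : octonion) : oct_al a = oct_al b -> oct_u a = oct_u b ->
  oct_v a = oct_v b -> oct_be a = oct_be b -> a = b.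
Proof.
by case: a b => [[[a u] v] b] [[[a' u'] v'] b'];
  rewrite /oct_al /oct_u /oct_v /oct_be /= => -> -> -> ->.
Qed.

Let i0 : 'I_3 := 0.
Let i1 : 'I_3 := 1.
Let i2 : 'I_3 := 2%:R.

Let dot3E u v : dot3 u v = u 0 i0 * v 0 i0 + u 0 i1 * v 0 i1 + u 0 i2 * v 0 i2.
Proof.
rewrite /dot3 !big_ord_recl big_ord0 addr0 addrA.
by congr (_ * _ + _ * _ + _ * _); congr (_ 0 _); apply: val_inj.
Qed.

Let cross3E u v :
  [/\ cross3 u v 0 i0 = u 0 i1 * v 0 i2 - u 0 i2 * v 0 i1,
      cross3 u v 0 i1 = u 0 i2 * v 0 i0 - u 0 i0 * v 0 i2 &
      cross3 u v 0 i2 = u 0 i0 * v 0 i1 - u 0 i1 * v 0 i0].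
Proof.
by rewrite !mxE; split; congr (_ * _ - _ * _); congr (_ 0 _); apply: val_inj.
Qed.
Let cross3E0 u v := let: And3 h _ _ := cross3E u v in h.
Let cross3E1 u v := let: And3 _ h _ := cross3E u v in h.
Let cross3E2 u v := let: And3 _ _ h := cross3E u v in h.

Let row3P (u v : 'rV[F]_3) :
  u 0 i0 = v 0 i0 -> u 0 i1 = v 0 i1 -> u 0 i2 = v 0 i2 -> u = v.
Proof.
move=> e0 e1 e2; apply/rowP => -[[|[|[|//]]] lti].
- by rewrite (_ : Ordinal _ = i0) //; apply: val_inj.
- by rewrite (_ : Ordinal _ = i1) //; apply: val_inj.
- by rewrite (_ : Ordinal _ = i2) //; apply: val_inj.
Qed.

Let mxDE (u v : 'rV[F]_3) i : (u + v) 0 i = u 0 i + v 0 i. Proof. exact: mxE. Qed.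
Let mxNE (u : 'rV[F]_3) i : (- u) 0 i = - u 0 i. Proof. exact: mxE. Qed.
Let mxZE c (u : 'rV[F]_3) i : (c *: u) 0 i = c * u 0 i. Proof. exact: mxE. Qed.
Let mx0E i : (0 : 'rV[F]_3) 0 i = 0. Proof. exact: mxE. Qed.

Let alM a b : oct_al (omul a b) = oct_al a * oct_al b + dot3 (oct_u a) (oct_v b).
Proof. by []. Qed.
Let uM a b : oct_u (omul a b) =
  oct_al a *: oct_u b + oct_be b *: oct_u a - cross3 (oct_v a) (oct_v b).
Proof. by []. Qed.
Let vM a b : oct_v (omul a b) =
  oct_al b *: oct_v a + oct_be a *: oct_v b + cross3 (oct_u a) (oct_u b).
Proof. by []. Qed.
Let beM a b : oct_be (omul a b) = oct_be a * oct_be b + dot3 (oct_v a) (oct_u b).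
Proof. by []. Qed.
Let alD a b : oct_al (a + b) = oct_al a + oct_al b. Proof. by []. Qed.
Let uD a b : oct_u (a + b) = oct_u a + oct_u b. Proof. by []. Qed.
Let vD a b : oct_v (a + b) = oct_v a + oct_v b. Proof. by []. Qed.
Let beD a b : oct_be (a + b) = oct_be a + oct_be b. Proof. by []. Qed.
Let alZ c a : oct_al (c *: a) = c * oct_al a. Proof. by []. Qed.
Let uZ c a : oct_u (c *: a) = c *: oct_u a. Proof. by []. Qed.
Let vZ c a : oct_v (c *: a) = c *: oct_v a. Proof. by []. Qed.
Let beZ c a : oct_be (c *: a) = c * oct_be a. Proof. by []. Qed.
Let al1 : oct_al oone = 1. Proof. by []. Qed.
Let u1 : oct_u oone = 0. Proof. by []. Qed.
Let v1 : oct_v oone = 0. Proof. by []. Qed.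
Let be1 : oct_be oone = 1. Proof. by []. Qed.

Let octE := (alM, uM, vM, beM, alD, uD, vD, beD, alZ, uZ, vZ, beZ, al1, u1, v1,
  be1).
Let coordE := (dot3E, cross3E0, cross3E1, cross3E2, mxDE, mxNE, mxZE, mx0E).

Lemma omulr_linear b : linear (omulr b).
Proof.
by move=> c x y; rewrite /omulr; apply: octP; rewrite !octE;
  [|apply: row3P|apply: row3P|]; rewrite !coordE; ring.
Qed.

Lemma omul_linear a : linear (omul a).
Proof.
by move=> c x y; apply: octP; rewrite !octE;
  [|apply: row3P|apply: row3P|]; rewrite !coordE; ring.
Qed.

HB.instance Definition _ a :=
  GRing.isLinear.Build F octonion octonion _ (omul a) (omul_linear a).
HB.instance Definition _ b :=
  GRing.isLinear.Build F octonion octonion _ (omulr b) (omulr_linear b).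

Lemma otr_linear : linear (otr : octonion -> F^o).
Proof. by move=> c x y; rewrite /otr !octE /GRing.scale /=; ring. Qed.

HB.instance Definition _ :=
  GRing.isLinear.Build F octonion F^o _ otr otr_linear.

Lemma otrN a : otr (- a) = - otr a. Proof. exact: (linearN otr). Qed.

Lemma onormM a b : onorm (omul a b) = onorm a * onorm b.
Proof. by rewrite /onorm !octE !coordE; ring. Qed.

Lemma omul1o a : omul oone a = a.
Proof.
by apply: octP; rewrite !octE; [|apply: row3P|apply: row3P|];
  rewrite !coordE; ring.
Qed.

Lemma omulo1 a : omul a oone = a.
Proof.
by apply: octP; rewrite !octE; [|apply: row3P|apply: row3P|];
  rewrite !coordE; ring.
Qed.

Lemma omul_altl a z : omul a (omul a z) = omul (omul a a) z.
Proof.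
by apply: octP; rewrite !octE; [|apply: row3P|apply: row3P|];
  rewrite !coordE; ring.
Qed.

Lemma omul_altr z a : omul (omul z a) a = omul z (omul a a).
Proof.
by apply: octP; rewrite !octE; [|apply: row3P|apply: row3P|];
  rewrite !coordE; ring.
Qed.

Lemma osqr_add1 x : onorm x = 1 ->
  omul (oone + x) (oone + x) = (2 + otr x) *: x.
Proof.
rewrite /onorm /otr dot3E => nx.
have nx' : oct_al x * oct_be x = 1 + (oct_u x 0 i0 * oct_v x 0 i0 +
  oct_u x 0 i1 * oct_v x 0 i1 + oct_u x 0 i2 * oct_v x 0 i2).
  by rewrite -nx; ring.
by apply: octP; rewrite !octE; [|apply: row3P|apply: row3P|];
  rewrite !coordE; ring: nx'.
Qed.

Lemma opolar1 a : opolar a oone = otr a.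
Proof. by rewrite /opolar /onorm /otr !octE !coordE; ring. Qed.

Lemma opolarxx a : opolar a a = 2 * onorm a.
Proof. by rewrite /opolar /onorm !octE !coordE; ring. Qed.

Lemma opolarE a b : opolar a b =
  oct_al a * oct_be b + oct_al b * oct_be a
  - dot3 (oct_u a) (oct_v b) - dot3 (oct_u b) (oct_v a).
Proof. by rewrite /opolar /onorm !octE !coordE; ring. Qed.

Lemma onormN a : onorm (- a) = onorm a.
Proof. by rewrite -scaleN1r /onorm !octE !coordE; ring. Qed.

Lemma onorm1 : onorm oone = 1.
Proof. by rewrite /onorm !octE !coordE; ring. Qed.

Lemma opolarC a b : opolar a b = opolar b a.
Proof. by rewrite !opolarE; ring. Qed.

Lemma opolar_linearr a : linear (opolar a : octonion -> F^o).
Proof.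
by move=> c x y; rewrite !opolarE !octE !coordE /GRing.scale /=; ring.
Qed.

HB.instance Definition _ a :=
  GRing.isLinear.Build F octonion F^o _ (opolar a) (opolar_linearr a).

Lemma opolar0r a : opolar a 0 = 0. Proof. exact: (linear0 (opolar a)). Qed.
Lemma opolarDr a b c : opolar a (b + c) = opolar a b + opolar a c.
Proof. exact: (linearD (opolar a)). Qed.
Lemma opolarZr a k b : opolar a (k *: b) = k * opolar a b.
Proof. exact: (linearZ_LR (opolar a)). Qed.
Lemma opolarNr a b : opolar a (- b) = - opolar a b.
Proof. exact: (linearN (opolar a)). Qed.

Lemma opolar_sumr a (I : Type) (r : seq I) (P : pred I) (E : I -> octonion) :
  opolar a (\sum_(i <- r | P i) E i) = \sum_(i <- r | P i) opolar a (E i).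
Proof. exact: (linear_sum (opolar a)). Qed.

Let dot3_delta u i : dot3 u (delta_mx 0 i) = u 0 i.
Proof.
rewrite /dot3 (bigD1 i) //= big1 ?addr0 => [|j ji]; rewrite !mxE.
  by rewrite !eqxx mulr1.
by rewrite (negPf ji) mulr0.
Qed.
Let dot30 u : dot3 u 0 = 0. Proof. by rewrite dot3E !mx0E; ring. Qed.
Let dot3C u v : dot3 u v = dot3 v u. Proof. by rewrite !dot3E; ring. Qed.

Lemma opolar_nondeg a : (forall b, opolar a b = 0) -> a = 0.
Proof.
move=> a0; apply: octP; last 1 first.
- have := a0 (mkoct 1 0 0 0); rewrite opolarE ![dot3 _ (oct_v _)]dot3C.
  by rewrite dot3C dot30 dot30 !subr0 mulr0 add0r mul1r.
- by have := a0 (mkoct 0 0 0 1); rewrite opolarE dot30 dot3C dot30;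
    rewrite !subr0 mul0r addr0 mulr1.
- apply/rowP => i; have := a0 (mkoct 0 0 (delta_mx 0 i) 0).
  rewrite opolarE dot3_delta dot3C dot30 mulr0 mul0r subr0 addr0 sub0r.
  by move=> /eqP; rewrite oppr_eq0 => /eqP ->; rewrite mxE.
- apply/rowP => i; have := a0 (mkoct 0 (delta_mx 0 i) 0 0).
  rewrite opolarE dot30 dot3C dot3_delta mulr0 mul0r subr0 addr0 sub0r.
  by move=> /eqP; rewrite oppr_eq0 => /eqP ->; rewrite mxE.
Qed.

Lemma dim_octonion : \dim {:octonion} = 8.
Proof. by rewrite dimvf. Qed.

End Octonions.

Definition ldet (F : fieldType) (V : vectType F) (f : 'End(V)) : F :=
  \det (mxof (vbasis {:V}) (vbasis {:V}) f).

Section LDet.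
Variables (F : fieldType) (V : vectType F).
Let eP : basis_of {:V} (vbasis {:V}) := vbasisP {:V}.

Lemma ldet1 : ldet (\1 : 'End(V))%VF = 1.
Proof. by rewrite /ldet mxof1 ?det1 // (basis_free eP). Qed.

Lemma ldetM (f g : 'End(V)) : ldet (f \o g)%VF = ldet f * ldet g.
Proof. by rewrite /ldet (mxof_comp _ _ eP) det_mulmx mulrC. Qed.

Lemma ldetZ a (f : 'End(V)) : ldet (a *: f) = a ^+ \dim {:V} * ldet f.
Proof. by rewrite /ldet linearZ detZ. Qed.

End LDet.

Section Groups.
Variable F : fieldType.
Local Notation O := (octonion F).

Definition so8 : {pred 'End(O)} :=
  [pred g : 'End(O) |
    `[< forall a b, opolar (g a) (g b) = opolar a b >] && (ldet g == 1)].

Lemma so8P (g : 'End(O)) :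
  reflect ((forall a b, opolar (g a) (g b) = opolar a b) /\ ldet g = 1)
          (g \in so8).
Proof.
by apply: (iffP andP) => -[/asboolP g1 /eqP g2]; split=> //; apply/asboolP.
Qed.

Lemma so8_lker0 (g : 'End(O)) : g \in so8 -> lker g == 0%VS.
Proof.
move=> /so8P[gq _]; apply/lker0P/raddf_inj => a ga0; apply: opolar_nondeg => b.
by rewrite -gq ga0 opolarC opolar0r.
Qed.

Lemma so8_1 : \1%VF \in so8.
Proof. by apply/so8P; split=> [a b|]; rewrite ?lfunE ?ldet1 //= lfunE. Qed.

Lemma so8_comp (g h : 'End(O)) :
  g \in so8 -> h \in so8 -> (g \o h)%VF \in so8.
Proof.
move=> /so8P[gq gd] /so8P[hq hd]; apply/so8P.
by split=> [a b|]; rewrite ?ldetM ?gd ?hd ?mulr1 // !lfunE /= gq hq.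
Qed.

Lemma so8_inv (g : 'End(O)) : g \in so8 -> (g^-1)%VF \in so8.
Proof.
move=> gso; have g0 := so8_lker0 gso; move/so8P: gso => [gq gd].
apply/so8P; split=> [a b|]; first by rewrite -gq !lker0_lfunVK.
by rewrite -[LHS]mul1r -gd -ldetM lker0_compfV // ldet1.
Qed.

Lemma so8N (g : 'End(O)) : g \in so8 -> - g \in so8.
Proof.
move=> /so8P[gq gd]; apply/so8P; split=> [a b|].
  by rewrite !opp_lfunE opolarNr opolarC opolarNr opolarC opprK gq.
by rewrite -scaleN1r ldetZ gd dim_octonion; ring.
Qed.

Definition SO8 := {g : 'End(O) | g \in so8}.
HB.instance Definition _ := SubChoice.on SO8.

Definition SO8_one : SO8 := exist _ \1%VF so8_1.
Definition SO8_mul (g h : SO8) : SO8 :=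
  exist _ (sval g \o sval h)%VF (so8_comp (svalP g) (svalP h)).
Definition SO8_inv (g : SO8) : SO8 := exist _ (sval g)^-1%VF (so8_inv (svalP g)).
Definition SO8_opp (g : SO8) : SO8 := exist _ (- sval g) (so8N (svalP g)).

Lemma SO8_mulA : associative SO8_mul.
Proof. by move=> f g h; apply: val_inj; rewrite /= comp_lfunA. Qed.
Lemma SO8_mul1 : left_id SO8_one SO8_mul.
Proof. by move=> g; apply: val_inj; rewrite /= comp_lfun1l. Qed.
Lemma SO8_mulr1 : right_id SO8_one SO8_mul.
Proof. by move=> g; apply: val_inj; rewrite /= comp_lfun1r. Qed.
Lemma SO8_mulV : left_inverse SO8_one SO8_inv SO8_mul.
Proof.
by move=> g; apply: val_inj; rewrite /= lker0_compVf // so8_lker0 ?(svalP g).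
Qed.
Lemma SO8_mulrV : right_inverse SO8_one SO8_inv SO8_mul.
Proof.
by move=> g; apply: val_inj; rewrite /= lker0_compfV // so8_lker0 ?(svalP g).
Qed.

HB.instance Definition _ := isGroup.Build SO8
  SO8_mulA SO8_mul1 SO8_mulr1 SO8_mulV SO8_mulrV.

Definition SO7 := {g : SO8 | sval g (oone F) == oone F}.

Definition pm_equiv (g h : SO8) : bool := (g == h) || (g == SO8_opp h).

Lemma SO8_oppK : involutive SO8_opp.
Proof. by move=> g; apply: val_inj; rewrite /= opprK. Qed.

Lemma pm_equivP : equiv_class_of pm_equiv.
Proof.
split=> [g|g h|h g k]; rewrite /pm_equiv.
- by rewrite eqxx.
- rewrite eq_sym; congr (_ || _).
  by rewrite -(inj_eq (inv_inj SO8_oppK)) SO8_oppK eq_sym.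
- case/orP=> /eqP->; case/orP=> /eqP->; rewrite ?SO8_oppK eqxx ?orbT //.
Qed.

Canonical pm_equiv_equiv := EquivRelPack pm_equivP.
Canonical pm_equiv_encModRel := defaultEncModRel pm_equiv.

Definition PSO8 := {eq_quot pm_equiv}.
HB.instance Definition _ := EqQuotient.on PSO8.
HB.instance Definition _ := Choice.on PSO8.

Definition pso8 (g : SO8) : PSO8 := \pi_PSO8 g.

Lemma pso8_eq g h : (pso8 g = pso8 h) <-> pm_equiv g h.
Proof. by split=> [/eqP|gh]; [|apply/eqP]; rewrite eqmodE. Qed.

Lemma pso8_repr x : pso8 (repr x) = x.
Proof. exact: reprK. Qed.

Definition PSO8_one : PSO8 := pso8 1%g.
Definition PSO8_mul (x y : PSO8) : PSO8 := pso8 (repr x * repr y)%g.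
Definition PSO8_inv (x : PSO8) : PSO8 := pso8 (repr x)^-1%g.

Lemma SO8_mulNl g h : (SO8_opp g * h)%g = SO8_opp (g * h)%g.
Proof. by apply: val_inj; apply: comp_lfunNl. Qed.
Lemma SO8_mulNr g h : (g * SO8_opp h)%g = SO8_opp (g * h)%g.
Proof. by apply: val_inj; apply: comp_lfunNr. Qed.
Lemma SO8_invN g : (SO8_opp g)^-1%g = SO8_opp g^-1%g.
Proof.
by apply: (mulgI (SO8_opp g)); rewrite mulgV SO8_mulNl SO8_mulNr SO8_oppK mulgV.
Qed.

Lemma PSO8_mulE g h : PSO8_mul (pso8 g) (pso8 h) = pso8 (g * h)%g.
Proof.
apply/pso8_eq; have /pso8_eq/orP[] := pso8_repr (pso8 g) => /eqP->;
  have /pso8_eq/orP[] := pso8_repr (pso8 h) => /eqP->;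
  by rewrite ?SO8_mulNl ?SO8_mulNr ?SO8_oppK /pm_equiv eqxx ?orbT.
Qed.

Lemma PSO8_invE g : PSO8_inv (pso8 g) = pso8 g^-1%g.
Proof.
apply/pso8_eq; have /pso8_eq/orP[] := pso8_repr (pso8 g) => /eqP->;
  by rewrite ?SO8_invN /pm_equiv eqxx ?orbT.
Qed.

Lemma PSO8_mulA : associative PSO8_mul.
Proof.
move=> x y z; rewrite -(pso8_repr x) -(pso8_repr y) -(pso8_repr z).
by rewrite !PSO8_mulE mulgA.
Qed.
Lemma PSO8_mul1 : left_id PSO8_one PSO8_mul.
Proof. by move=> x; rewrite -(pso8_repr x) PSO8_mulE mul1g. Qed.
Lemma PSO8_mulr1 : right_id PSO8_one PSO8_mul.
Proof. by move=> x; rewrite -(pso8_repr x) PSO8_mulE mulg1. Qed.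
Lemma PSO8_mulV : left_inverse PSO8_one PSO8_inv PSO8_mul.
Proof. by move=> x; rewrite -(pso8_repr x) PSO8_invE PSO8_mulE mulVg. Qed.
Lemma PSO8_mulrV : right_inverse PSO8_one PSO8_inv PSO8_mul.
Proof. by move=> x; rewrite -(pso8_repr x) PSO8_invE PSO8_mulE mulgV. Qed.

HB.instance Definition _ := isGroup.Build PSO8
  PSO8_mulA PSO8_mul1 PSO8_mulr1 PSO8_mulV PSO8_mulrV.

End Groups.

Section Triality.
Variable F : fieldType.
Local Notation O := (octonion F).
Local Notation q := (@opolar F).

Definition lmul (x : O) : 'End(O) := linfun (omul x).
Definition rmul (x : O) : 'End(O) := linfun (omulr x).

Lemma ldet_sim (g : 'End(O)) (m : F) :
  (forall a b, q (g a) (g b) = m * q a b) -> ldet g ^+ 2 = m ^+ 8.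
Proof.
move=> gq; pose e := vbasis {:O}; pose M := mxof e e g.
have eB : basis_of {:O} e := vbasisP _.
pose J : 'M_(\dim {:O}) := \matrix_(i, j) q e`_i e`_j.
have JE (u : 'rV_(\dim {:O})) j : (u *m J) 0 j = q (vecof e u) e`_j.
  rewrite mxE opolarC /vecof opolar_sumr; apply: eq_bigr => i _.
  by rewrite mxE opolarC; rewrite opolarZr.
have Junit : J \in unitmx.
  rewrite -row_free_unit -kermx_eq0; apply/rowV0P => u /sub_kermxP uJ0.
  apply/eqP; rewrite -(vecof_eq0 eB); apply/eqP/opolar_nondeg => b.
  rewrite (coord_basis eB (memvf b)) opolar_sumr big1 // => i _.
  by rewrite opolarZr -JE uJ0 mxE mulr0.
have MJM : M *m J *m M^T = m *: J.
  apply/matrixP => i j; rewrite [RHS]mxE.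
  have rowM k : row k M = rVof e (g e`_k).
    by apply/rowP => l; rewrite !mxE /= vecof_delta.
  transitivity (q (g e`_i) (g e`_j)); last by rewrite gq mxE.
  rewrite mxE (coord_basis eB (memvf (g e`_j))) opolar_sumr.
  apply: eq_bigr => k _; rewrite [RHS]opolarZr mulrC; congr (_ * _).
    by rewrite !mxE /= vecof_delta.
  have := JE (row i M) k; rewrite rowM rVofK // => <-.
  by rewrite -rowM -row_mul [RHS]mxE.
have := congr1 determinant MJM; rewrite !det_mulmx det_tr detZ -/M.
have -> : m ^+ \dim {:O} = m ^+ 8 by rewrite dim_octonion.
rewrite -/(ldet g) => dJ.
have Jn0 : \det J != 0 by rewrite -unitfE -unitmxE.
by apply: (mulIf Jn0); rewrite -dJ expr2; ring.
Qed.

Lemma opolarM (x a b : O) : q (omul x a) (omul x b) = onorm x * q a b.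
Proof. by rewrite /opolar -linearD !onormM; ring. Qed.

Lemma opolarMr (x a b : O) : q (omul a x) (omul b x) = onorm x * q a b.
Proof.
have := linearD (omulr x) a b; rewrite /omulr /= /opolar => <-.
by rewrite !onormM; ring.
Qed.

Lemma mul_so8 (x : O) (m : O -> 'End(O)) : 2 != 0 :> F ->
  (forall c x y, m (c *: x + y) = c *: m x + m y) ->
  (forall y, m (omul y y) = (m y \o m y)%VF) -> m (oone F) = \1%VF ->
  (forall x a b, q (m x a) (m x b) = onorm x * q a b) ->
  onorm x = 1 -> m x \in @so8 F.
Proof.
move=> F2 mP msq m1 mq nx; apply/so8P; split=> [a b|].
  by rewrite mq nx mul1r.
have mZ c y : m (c *: y) = c *: m y.
  have m0 : m 0 = 0.
    by apply: (addIr (m 0)); rewrite add0r -{1}[m 0]scale1r -mP scale1r addr0.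
  by rewrite -[c *: y]addr0 mP m0 addr0.
wlog tx : x nx / 2 + otr x != 0 => [hwlog|].
  have [tx0|/hwlog] := eqVneq (2 + otr x) 0; last exact.
  have tx : otr x = - 2 by apply/eqP; rewrite -addr_eq0 addrC tx0.
  rewrite -[x]opprK -scaleN1r mZ ldetZ dim_octonion.
  rewrite hwlog ?onormN //; first by ring.
  rewrite otrN tx opprK -natrD (_ : (2 + 2 = 2 * 2)%N) // natrM.
  by rewrite mulf_neq0.
have sq := osqr_add1 nx; have := congr1 (fun y => ldet (m y)) sq.
rewrite /= msq mZ ldetM ldetZ dim_octonion -expr2.
rewrite (@ldet_sim _ (2 + otr x)) => [|a b]; last first.
  rewrite mq; congr (_ * _); have := congr1 (@onorm F) sq.
  have := opolarxx (oone F + x).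
  rewrite opolarDr [q _ (oone F)]opolarC [q _ x]opolarC !opolarDr.
  rewrite [q (oone F) x]opolarC !opolarxx opolar1 nx.
  rewrite onorm1.
  by move=> h _; apply: (mulfI F2); rewrite -h; ring.
move=> h; apply: (mulfI (expf_neq0 8 tx)).
by rewrite mulr1 -h.
Qed.

Lemma lmul_so8 (x : O) : 2 != 0 :> F -> onorm x = 1 -> lmul x \in @so8 F.
Proof.
move=> F2; apply: (mul_so8 F2) => [c y z|y||y a b].
- apply/lfunP => a; rewrite add_lfunE scale_lfunE !lfunE /=.
  exact: (linearP (omulr a)).
- by apply/lfunP => a; rewrite !lfunE /= !lfunE /= omul_altl.
- by apply/lfunP => a; rewrite !lfunE /= omul1o.
- by rewrite !lfunE /= opolarM.
Qed.

Lemma rmul_so8 (x : O) : 2 != 0 :> F -> onorm x = 1 -> rmul x \in @so8 F.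
Proof.
move=> F2; apply: (mul_so8 F2) => [c y z|y||y a b].
- apply/lfunP => a; rewrite add_lfunE scale_lfunE !lfunE /=.
  exact: (linearP (omul a)).
- by apply/lfunP => a; rewrite !lfunE /= !lfunE /= /omulr omul_altr.
- by apply/lfunP => a; rewrite !lfunE /= /omulr omulo1.
- by rewrite !lfunE /= /omulr opolarMr.
Qed.

(* The class in PSO(8) of an element of SO(8), and 1 off SO(8).  By lmul_so8  *)
(* and rmul_so8 the default value is never used in trL x and trR x when       *)
(* onorm x = 1 and 2 is invertible.                                           *)
Definition pso8_of (g : 'End(O)) : PSO8 F := pso8 (insubd (1%g : SO8 F) g).

Definition trL (x : O) : PSO8 F := pso8_of (lmul x).
Definition trR (x : O) : PSO8 F := pso8_of (rmul x).
Definition trP (x : O) : PSO8 F := ((trL x)^-1 * (trR x)^-1)%g.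

(* Quantifying over octonions x of norm 1 amounts to quantifying over M, as   *)
(* trL x, trR x and trP x do not change when x is replaced by - x.            *)
Record is_triality (rho : PSO8 F -> PSO8 F) : Prop := IsTriality {
  triality_bij : bijective rho;
  trialityM : {morph rho : g h / (g * h)%g};
  triality3 : forall g, rho (rho (rho g)) = g;
  triality_neq_id : exists g, rho g <> g;
  trialityR : forall x, onorm x = 1 -> rho (trR x) = trP x;
  trialityL : forall x, onorm x = 1 -> rho (trL x) = trR x;
  trialityP : forall x, onorm x = 1 -> rho (trP x) = trL x
}.

(* Independent of the representative by PSO8_S2E.                             *)
Definition PSO8_S2 (g : PSO8 F) (v : sympow 2 O) : sympow 2 O :=
  smap (sval (repr g)) v.

Lemma PSO8_S2E (g : SO8 F) v : PSO8_S2 (pso8 g) v = smap (sval g) v.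
Proof.
have /pso8_eq/orP[] := pso8_repr (pso8 g); rewrite /PSO8_S2 => /eqP-> //=.
by rewrite smap2N.
Qed.

Lemma PSO8_S2M (g h : PSO8 F) v : PSO8_S2 (g * h)%g v = PSO8_S2 g (PSO8_S2 h v).
Proof.
have SM (a b : SO8 F) : PSO8_S2 (pso8 a * pso8 b)%g v =
    PSO8_S2 (pso8 a) (PSO8_S2 (pso8 b) v).
  by rewrite [(_ * _)%g]PSO8_mulE !PSO8_S2E; apply: smap_comp.
by have := SM (repr g) (repr h); rewrite !pso8_repr.
Qed.

Definition oct0 : {vspace O} := lker (linfun (@otr F : O -> F^o)).

Lemma mem_oct0 a : (a \in oct0) = (otr a == 0).
Proof. by rewrite memv_ker lfunE. Qed.

(* The restriction of g when g preserves oct0, as in oct0_resE; otherwise     *)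
(* followed by a projection onto oct0.                                        *)
Definition oct0_res (g : 'End(O)) : 'End(subvs_of oct0) :=
  linfun (vsproj oct0 \o g \o vsval).

Lemma oct0_resE (g : SO7 F) (a : subvs_of oct0) :
  vsval (oct0_res (sval (sval g)) a) = sval (sval g) (vsval a).
Proof.
rewrite lfunE /= vsprojK // mem_oct0.
have /so8P[/(_ (vsval a) (oone F)) gq _] := svalP (sval g).
have g1 : sval (sval g) (oone F) = oone F := eqP (svalP g).
by rewrite g1 !opolar1 in gq; rewrite gq -mem_oct0 subvsP.
Qed.

End Triality.

Definition module_iso (F : fieldType) (G : Type) (V W : lmodType F)
    (actV : G -> V -> V) (actW : G -> W -> W) : Prop :=
  exists phi : {linear V -> W},
    bijective phi /\ forall g v, phi (actV g v) = actW g (phi v).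

Definition SO7_twisted_S2 (F : fieldType) (rho : PSO8 F -> PSO8 F)
    (g : SO7 F) (v : sympow 2 (octonion F)) : sympow 2 (octonion F) :=
  PSO8_S2 (rho (pso8 (sval g))) v.

Definition SO7_ext (F : fieldType) (k : nat) (g : SO7 F)
    (v : extpow k (subvs_of (oct0 F))) : extpow k (subvs_of (oct0 F)) :=
  emap (oct0_res (sval (sval g))) v.

Definition act_sum (G V W : Type) (actV : G -> V -> V) (actW : G -> W -> W)
    (g : G) (v : V * W) : V * W := (actV g v.1, actW g v.2).

(* Main.v *)
Require Import Defs.
From HB Require Import structures.
From mathcomp Require Import all_boot all_order all_algebra.
From mathcomp Require Import perm generic_quotient ring_quotient.
From mathcomp Require Import boolp ring.

Set Implicit Arguments.
Unset Strict Implicit.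
Unset Printing Implicit Defensive.

Import GRing.Theory passmx.
Local Open Scope ring_scope.
Local Open Scope quotient_scope.

(** Write L_a and R_a for the multiplications by the octonion a, and q for the
    polar form of the norm.

    The triples (A, B, C) with A(x) B(y) = C(x y) are closed under composition,
    and the Moufang identities say that (L_a, R_a, L_a R_a) and
    (R_a, L_a^-1 R_a^-1, R_a^-1) are such triples when n(a) = 1.  So the
    triality automorphism sends the class of A to the class of B as soon as A is
    a product of maps L_a and R_a.  Every A in SO(8) is: by Cartan-Dieudonne it
    is a product of reflections, an even number of them because of the
    determinant, and the product of the reflections in a and b is
    L_a R_a R_b' L_b' with b' the conjugate of b.  When A fixes 1, putting x = 1
    gives B = C; hence the twisted action of g in SO(7) is the action of some
    isometry B with g(x) B(y) = B(x y), the spin representation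
    ([triality_spin]).

    For such a pair, B intertwines L_x with L_(g x).  If e is an orthonormal
    basis of the octonions (there is one, as -1 is a square), then for k = 0
    and k = 3
      x_1 /\ ... /\ x_k  |->  sum_i (L_(x_1) ... L_(x_k) e_i) . e_i
    is an equivariant map from the k-th exterior power of the traceless octonions
    to the symmetric square.  It is alternating because T |-> sum_i (T e_i) . e_i
    kills skew operators, the L_w with w traceless are skew, and
    L_x L_y L_z is a multiple of some such L_w if two of x, y, z are
    equal ([casimir_alt3]).  No division by 3! occurs, so that characteristic 3
    needs no separate treatment.

    The sum of the maps for k = 0 and k = 3 is onto: the 3-form invariant under
    the automorphisms of the octonions gives 1 . 1 ([in_im_one]), the image is
    stable under s . t |-> L_a s . L_a t for a traceless of norm 1, so it contains
    a . a = L_a 1 . L_a 1, by polarization all products of two traceless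
    octonions, and 1 . z = L_a a . L_a (a z) for traceless z and a with a
    orthogonal to z and of norm 1.  It is injective because 1 + 'C(7, 3) = 36 = 'C(9, 2). *)

(** * Quotients by spanned subspaces *)

Section QSpace.
Variables (F : fieldType) (V : vectType F) (S : V -> Prop).

(** A subspace of maximal dimension among those where [P] holds contains [S]:
    adding to it the line of some [s] with [S s] keeps [P]. *)
Lemma spanned_ind (P : V -> Prop) :
  P 0 -> (forall a u v, P u -> P v -> P (a *: u + v)) ->
  (forall s, S s -> P s) -> forall t, t \in spanned S -> P t.
Proof.
move=> P0 PL PS.
pose good n := `[< exists2 U : {vspace V}, \dim U = n & forall u, u \in U -> P u >].
have good0 : exists n, good n.
  by exists 0%N; apply/asboolP; exists 0%VS; rewrite ?dimv0 // => u /[1!memv0]/eqP->.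
have goodb n : good n -> (n <= \dim {:V})%N.
  by move=> /asboolP[U <- _]; apply/dimvS/subvf.
have [n /asboolP[U dU PU] maxU] := ex_maxnP good0 goodb.
move=> t /spannedP/(_ U) tU; apply/PU/tU => s Ss.
apply: contraT => sU; have : good (\dim (<[s]> + U)%VS).
  apply/asboolP; exists (<[s]> + U)%VS => // _ /memv_addP[_ /vlineP[a ->] [u Uu ->]].
  by apply: PL; [apply: PS | apply: PU].
move/maxU; rewrite -dU leqNgt => /negP[].
rewrite ltn_neqAle dimvS ?addvSr // andbT.
apply: contraNneq sU => dUE; have /eqP-> : (U == <[s]> + U)%VS.
  by rewrite eqEdim addvSr dUE leqnn.
by rewrite memvE addvSl.
Qed.

Section Lift.
Variables (W : lmodType F) (f : {linear V -> W}).
Hypothesis fS : forall s, S s -> f s = 0.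

(** The proof is an argument so that the linear structure below, which depends on
    it, can be inferred from the map. *)
Definition qlift of (forall s, S s -> f s = 0) := fun x : qspace S => f (repr x).

Lemma qlift_pi t : qlift fS (\pi_(qspace S) t) = f t.
Proof.
apply/eqP; rewrite -subr_eq0 -linearB; apply/eqP.
have : repr (\pi_(qspace S) t) - t \in spanned S by rewrite -qspace_eq reprK.
apply: (spanned_ind (P := fun r => f r = 0)) => [|a u v|s /fS //].
  exact: linear0.
by rewrite linearP => -> ->; rewrite scaler0 addr0.
Qed.

Lemma qlift_linear : linear (qlift fS).
Proof.
move=> a; elim/quotW=> x; elim/quotW=> y.
by rewrite -(@qpi_linear _ _ S a x y) !qlift_pi linearP.
Qed.
HB.instance Definition _ := GRing.isLinear.Build F _ _ _ (qlift fS) qlift_linear.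
End Lift.

HB.instance Definition _ :=
  GRing.isLinear.Build F V (qspace S) _ _ (@qpi_linear F V S).

End QSpace.

(** * Tensor, symmetric and exterior powers *)

Lemma ffunZE (F : fieldType) (I : finType) a (f : {ffun I -> F^o}) i :
  (a *: f) i = a * f i.
Proof. exact: ffunE. Qed.

Section TensorPower.
Variables (F : fieldType) (k : nat) (V : vectType F).
Implicit Types v : 'I_k -> V.

Lemma eq_tprod v w : v =1 w -> tprod v = tprod w.
Proof. by move=> /funext ->. Qed.

Lemma tpow_basisE (t : tpow k V) :
  t = \sum_i (t i : F) *: tprod (fun j => (vbasis {:V})`_(i j)).
Proof.
rewrite -[LHS]tmap1; apply: eq_bigr => i _; congr (_ *: _).
by apply: eq_tprod => j; rewrite lfunE.
Qed.

Definition upd v i x : 'I_k -> V := fun j => if j == i then x else v j.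

Lemma updE v i : upd v i (v i) = v.
Proof. by apply/funext => j; rewrite /upd; case: eqP => // ->. Qed.

Lemma tprod_upd_linear v i : linear (fun x => tprod (upd v i x)).
Proof.
move=> a x y; apply/ffunP => l; rewrite [RHS]ffunE tpowZE [LHS]ffunE [X in a * X]ffunE.
rewrite [X in _ = _ + X]ffunE.
rewrite [LHS](bigD1 i) // [X in a * X](bigD1 i) // [X in _ = _ + X](bigD1 i) //=.
rewrite /upd !eqxx linearP /= mulrDl -mulrA.
by congr (_ * (_ * _) + _ * _); apply: eq_bigr => j /negPf->.
Qed.

End TensorPower.

Section SymmetricSquare.
Variables (F : fieldType).
Implicit Types V W : vectType F.

Definition pair2 V (x y : V) : 'I_2 -> V := fun j => if j == 0 then x else y.

Definition sprod V (x y : V) : sympow 2 V :=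
  \pi_(qspace (@sym_rel F 2 V)) (tprod (pair2 x y)).

Lemma pair2E V (v : 'I_2 -> V) : v =1 pair2 (v 0) (v 1).
Proof. by case=> [[|[|//]] lti]; rewrite /pair2 /=; congr v; apply: val_inj. Qed.

Lemma tprod_sprod V (v : 'I_2 -> V) :
  \pi_(qspace (@sym_rel F 2 V)) (tprod v) = sprod (v 0) (v 1).
Proof. by rewrite (eq_tprod (pair2E v)). Qed.

Lemma sprodC V (x y : V) : sprod x y = sprod y x.
Proof.
apply/eqP; rewrite qspace_eq; apply: mem_spanned.
exists (pair2 x y), (tperm 0 1); congr (_ - _); apply: eq_tprod => j /=.
by case: tpermP => [->|->|/eqP/negPf j0 /eqP/negPf j1]; rewrite /pair2 ?j0 //;
  move: j j0 j1 => [[|[|]]].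
Qed.

Lemma sprod_linear V (y : V) : linear (sprod y).
Proof.
move=> a x z; rewrite /sprod -(@qpi_linear _ _ (@sym_rel F 2 V)).
apply: congr1; rewrite -[in RHS](updE (pair2 y x) 1).
have -> : pair2 y z = upd (pair2 y x) 1 z by apply/funext; case=> [[|[|]]].
by rewrite -(tprod_upd_linear _ 1); apply: eq_tprod; case=> [[|[|]]].
Qed.
HB.instance Definition _ V y :=
  GRing.isLinear.Build F V (sympow 2 V) _ (sprod y) (@sprod_linear V y).

Lemma sprodDr V (x y z : V) : sprod x (y + z) = sprod x y + sprod x z.
Proof. exact: linearD. Qed.
Lemma sprodZr V a (x y : V) : sprod x (a *: y) = a *: sprod x y.
Proof. exact: linearZ. Qed.
Lemma sprodDl V (x y z : V) : sprod (x + y) z = sprod x z + sprod y z.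
Proof. by rewrite ![sprod _ z]sprodC sprodDr. Qed.
Lemma sprodZl V a (x y : V) : sprod (a *: x) y = a *: sprod x y.
Proof. by rewrite ![sprod _ y]sprodC sprodZr. Qed.
Lemma sprod_suml V (I : finType) (f : I -> V) (y : V) :
  sprod (\sum_i f i) y = \sum_i sprod (f i) y.
Proof. by rewrite sprodC linear_sum; apply: eq_bigr => i _; rewrite sprodC. Qed.

Lemma sympow2_ind V (P : sympow 2 V -> Prop) :
  P 0 -> (forall a u v, P u -> P v -> P (a *: u + v)) ->
  (forall x y, P (sprod x y)) -> forall s, P s.
Proof.
move=> P0 PL Psp; elim/quotW=> t; rewrite (tpow_basisE t) linear_sum.
apply: (big_ind P) => // [u v Pu Pv|i _]; first by rewrite -[u]scale1r; apply: PL.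
by rewrite linearZ /= tprod_sprod -[X in P X]addr0; apply: PL.
Qed.

Lemma sprodNN V (x y : V) : sprod (- x) (- y) = sprod x y.
Proof.
by rewrite -scaleN1r -(scaleN1r y) sprodZl sprodZr scalerA mulrNN mulr1 scale1r.
Qed.

Lemma smap_linear V W (f : 'Hom(V, W)) : linear (smap f : sympow 2 V -> sympow 2 W).
Proof.
move=> a; elim/quotW=> x; elim/quotW=> y.
by rewrite -(@qpi_linear _ _ (@sym_rel F 2 V)) !smap_pi linearP linearP.
Qed.
HB.instance Definition _ V W (f : 'Hom(V, W)) :=
  GRing.isLinear.Build F _ _ _ (smap f : sympow 2 V -> sympow 2 W) (smap_linear f).

Lemma smap_sprod V W (f : 'Hom(V, W)) x y : smap f (sprod x y) = sprod (f x) (f y).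
Proof. by rewrite /sprod smap_pi tmap_tprod; apply/congr1/eq_tprod; case=> [[|[|]]]. Qed.

(** The entries t i j + t j i with i <= j of a tensor t of degree 2 only depend on
    its class, and can be prescribed when 2 is invertible: this bounds below the
    dimension of the symmetric square. *)
Definition sym_index V := {t : 2.-tuple 'I_(\dim {:V}) | sorted leq (map val t)}.
Definition index2 V (i j : 'I_(\dim {:V})) : {ffun 'I_2 -> 'I_(\dim {:V})} :=
  [ffun l => if l == 0 then i else j].
Definition sym_entries V (t : tpow 2 V) : {ffun sym_index V -> F^o} :=
  [ffun s => t (index2 (tnth (val s) 0) (tnth (val s) 1)) +
             t (index2 (tnth (val s) 1) (tnth (val s) 0))].

Lemma sym_entries_linear V : linear (@sym_entries V).
Proof.
move=> a t u; apply/ffunP => s; rewrite [in RHS]ffunE ffunZE !ffunE.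
by rewrite mulrDr addrACA.
Qed.
HB.instance Definition _ V :=
  GRing.isLinear.Build F _ _ _ (@sym_entries V) (@sym_entries_linear V).

Lemma sym_entries_rel V (t : tpow 2 V) : sym_rel t -> sym_entries t = 0.
Proof.
move=> [v [s ->]]; apply/ffunP => p; rewrite !ffunE.
rewrite !big_ord_recl !big_ord0 /= !ffunE /= !mulr1.
have: s ord0 != s (lift ord0 ord0) by rewrite (inj_eq perm_inj).
have ord2 (l : 'I_2) : l = ord0 \/ l = lift ord0 ord0.
  by case: l => [[|[|//]] ?]; [left | right]; apply: val_inj.
by have [->|->] := ord2 (s ord0); have [->|->] := ord2 (s (lift ord0 ord0));
  rewrite ?eqxx // => _; ring.
Qed.

Definition sympow_entries V : sympow 2 V -> {ffun sym_index V -> F^o} :=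
  qlift (@sym_entries_rel V).
HB.instance Definition _ V :=
  GRing.Linear.copy (@sympow_entries V) (qlift (@sym_entries_rel V)).

Lemma sympow_entries_surj V (d : {ffun sym_index V -> F^o}) :
  2 != 0 :> F -> exists y, sympow_entries y = d.
Proof.
move=> F2; pose c (s : sym_index V) : F :=
  if tnth (val s) 0 == tnth (val s) 1 then 2^-1 else 1.
pose ix (s : sym_index V) := index2 (tnth (val s) 0) (tnth (val s) 1).
(* The prescribed entries above the diagonal, half of them on the diagonal. *)
pose t : tpow 2 V := [ffun i => \sum_s (d s : F) * (c s * (i == ix s)%:R)].
exists (\pi_(qspace (@sym_rel F 2 V)) t).
have index2_inj (a b a' b' : 'I_(\dim {:V})) :
    index2 a b = index2 a' b' -> a = a' /\ b = b'.
  by move=> /ffunP e; have := e 0; have := e 1; rewrite !ffunE.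
rewrite /sympow_entries qlift_pi; apply/ffunP => s; rewrite !ffunE.
have sP (u v : sym_index V) : tnth (val u) 0 = tnth (val v) 0 ->
    tnth (val u) 1 = tnth (val v) 1 -> u = v.
  move=> e0 e1; apply/val_inj/eq_from_tnth; case=> [[|[|//]] lti].
    by rewrite (_ : Ordinal lti = 0) //; apply: val_inj.
  by rewrite (_ : Ordinal lti = 1) //; apply: val_inj.
have le01 (u : sym_index V) : (tnth (val u) 0%R <= tnth (val u) 1%R)%N.
  by case: u => [[[|a [|b [|]]] //= ul]] /=; rewrite andbT => ab; rewrite !(tnth_nth a).
rewrite -big_split (bigD1 s) //= big1 ?addr0 => [|u us].
  rewrite -!mulrDr /ix eqxx /c; case: eqP => [e|ne].
    by rewrite e eqxx -natrD mulVf // mulr1.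
  case: eqP => [/index2_inj[/esym//]|_].
  by rewrite mulr1n addr0 !mulr1.
rewrite -!mulrDr; case: eqP => [/index2_inj[e0 e1]|_].
  by case/eqP: us; apply: sP.
case: eqP => [/index2_inj[e1 e0]|_]; last by rewrite addr0 !mulr0.
case/eqP: us; have e : tnth (val s) 0 = tnth (val s) 1 :> 'I__.
  by apply/val_inj/anti_leq; rewrite le01 /= e0 e1 le01.
by apply: sP; rewrite -?e0 -?e1.
Qed.

Lemma card_sym_index V : #|{: sym_index V}| = 'C((\dim {:V}).+1, 2).
Proof.
rewrite card_sig; case: (\dim {:V}) => [|n].
  by rewrite eq_card0 // => t; case: (tnth t 0).
by rewrite -[n.+2]add2n -card_sorted_tuples cardsE.
Qed.

End SymmetricSquare.

Section ExteriorPower.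
Variables (F : fieldType) (k : nat) (V : vectType F).
Implicit Types v : 'I_k -> V.

Definition wedge v : extpow k V := \pi_(qspace (@alt_rel F k V)) (tprod v).

Lemma wedge_alt v i j : i != j -> v i = v j -> wedge v = 0.
Proof.
move=> ij vij; rewrite /wedge -[RHS](linear0 \pi_(qspace (@alt_rel F k V))).
by apply/eqP; rewrite qspace_eq subr0; apply: mem_spanned; exists v, i, j.
Qed.

Lemma wedge_upd_linear v i : linear (fun x => wedge (upd v i x)).
Proof.
by move=> a x y; rewrite /wedge (tprod_upd_linear v i) -(@qpi_linear _ _ (@alt_rel F k V)).
Qed.

(** Expand the wedge product that has v i + v j at both places i and j. *)
Lemma wedge_tperm v i j : i != j -> wedge (v \o tperm i j) = - wedge v.
Proof.
move=> ij; pose w x y := wedge (upd (upd v i x) j y).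
have wDl x y z : w (x + y) z = w x z + w y z.
  rewrite /w; have C x' : upd (upd v i x') j z = upd (upd v j z) i x'.
    apply/funext => l; rewrite /upd; case: eqP => // ->.
    by rewrite eq_sym (negPf ij).
  by rewrite !C -[x]scale1r wedge_upd_linear !scale1r.
have wDr x y z : w x (y + z) = w x y + w x z.
  by rewrite /w -[y]scale1r wedge_upd_linear !scale1r.
have w0 x : w x x = 0.
  by apply: (wedge_alt ij); rewrite /upd eqxx (negPf ij) eqxx.
have := w0 (v i + v j); rewrite wDl !wDr !w0 addr0 add0r => /eqP.
rewrite addrC addr_eq0 => /eqP; rewrite /w !updE => <-.
congr wedge; apply/funext => l /=; rewrite /upd.
case: tpermP => [->|->|/eqP/negPf-> /eqP/negPf-> //]; rewrite ?eqxx //.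
by rewrite (negPf ij).
Qed.

Lemma wedge_perm v (s : 'S_k) : wedge (v \o s) = (-1) ^+ s *: wedge v.
Proof.
have [ts -> dts] := prod_tpermP s.
elim: ts v dts => [|[i j] ts IH] v /=.
  rewrite big_nil odd_perm1 scale1r => _; congr wedge; apply/funext => l /=.
  by rewrite perm1.
case/andP=> /= ij /IH{}IH; rewrite big_cons odd_mul_tperm ij /=.
have -> : v \o (tperm i j * \prod_(t <- ts) tperm t.1 t.2)%g =
    (v \o (\prod_(t <- ts) tperm t.1 t.2)%g) \o tperm i j.
  by apply/funext => l; rewrite /= permM.
by rewrite wedge_tperm // IH signrN scaleNr.
Qed.

Lemma extpow_ind (P : extpow k V -> Prop) :
  P 0 -> (forall a x y, P x -> P y -> P (a *: x + y)) ->
  (forall i : 'I_k -> 'I_(\dim {:V}), P (wedge (fun j => (vbasis {:V})`_(i j)))) ->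
  forall s, P s.
Proof.
move=> P0 PL Psp; elim/quotW=> t; rewrite (tpow_basisE t) linear_sum.
apply: (big_ind P) => // [u v Pu Pv|i _]; first by rewrite -[u]scale1r; apply: PL.
by rewrite linearZ /= -[X in P X]addr0; apply: PL => //; apply: Psp.
Qed.

Definition alt_index := {t : k.-tuple 'I_(\dim {:V}) | sorted ltn (map val t)}.
Definition alt_span (c : {ffun alt_index -> F^o}) : extpow k V :=
  \sum_s (c s : F) *: wedge (fun j => (vbasis {:V})`_(tnth (val s) j)).

Lemma alt_span_linear : linear alt_span.
Proof.
move=> a c d; rewrite /alt_span scaler_sumr -big_split; apply: eq_bigr => s _ /=.
by rewrite ffunE ffunZE scalerDl scalerA.
Qed.
HB.instance Definition _ := GRing.isLinear.Build F _ _ _ alt_span alt_span_linear.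

Lemma alt_span_surj x : exists c, alt_span c = x.
Proof.
apply: (extpow_ind (P := fun x => exists c, alt_span c = x)) => [|a _ _ [c <-] [d <-]|i].
- by exists 0; rewrite linear0.
- by exists (a *: c + d); rewrite linearP.
(* A wedge of basis vectors is 0 if two of them are equal; otherwise sort them. *)
have [/injectiveP inj_i|/injectivePn[j [l jl ijl]]] := boolP (injectiveb i); last first.
  by exists 0; rewrite linear0 (wedge_alt jl) // ijl.
pose t := [tuple i j | j < k].
have sortedP : sorted ltn (map val (sort_tuple (fun a b : 'I__ => a <= b)%N t)).
  rewrite ltn_sorted_uniq_leq map_inj_uniq; last exact: val_inj.
  rewrite sort_uniq map_inj_uniq // -?enumT ?enum_uniq //= sorted_map.
  by apply: sort_sorted => a b; apply: leq_total.
have /tuple_permP[p tp] : perm_eq t (sort_tuple (fun a b : 'I__ => a <= b)%N t).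
  by rewrite perm_sym perm_sort.
pose s : alt_index :=
  exist (fun t : k.-tuple 'I__ => sorted ltn (map val t)) _ sortedP.
exists [ffun u => (u == s)%:R * (-1) ^+ p].
rewrite /alt_span (bigD1 s) //= big1 ?addr0 => [|u /negPf us]; last first.
  by rewrite ffunE us mul0r scale0r.
rewrite ffunE eqxx mul1r -wedge_perm; congr wedge; apply/funext => j /=.
congr (_ `_ (val _)); have := congr1 (fun u : k.-tuple 'I__ => tnth u j) (val_inj tp : t = _).
by rewrite !tnth_mktuple.
Qed.

Lemma card_alt_index : #|{: alt_index}| = 'C(\dim {:V}, k).
Proof. by rewrite card_sig -card_ltn_sorted_tuples cardsE. Qed.

End ExteriorPower.

Section ExteriorMap.
Variables (F : fieldType) (k : nat).
Implicit Types V W : vectType F.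

Lemma emap_linear V W (f : 'Hom(V, W)) : linear (emap f : extpow k V -> extpow k W).
Proof.
move=> a; elim/quotW=> x; elim/quotW=> y.
by rewrite -(@qpi_linear _ _ (@alt_rel F k V)) !emap_pi linearP linearP.
Qed.
HB.instance Definition _ V W (f : 'Hom(V, W)) :=
  GRing.isLinear.Build F _ _ _ (emap f : extpow k V -> extpow k W) (emap_linear f).

Lemma emap_wedge V W (f : 'Hom(V, W)) v :
  emap f (wedge v : extpow k V) = wedge (f \o v).
Proof. by rewrite /wedge emap_pi tmap_tprod. Qed.
End ExteriorMap.

(** A dimension count that does without bases of [V] and [W]: the composite of the
    three surjections maps a space onto one of at least the same dimension, so it
    is injective, and [A] is onto. *)
Lemma surj_inj_count (F : fieldType) (I J : finType) (V W : lmodType F)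
    (f : V -> W) (A : {ffun I -> F^o} -> V) (T : W -> {ffun J -> F^o}) :
  linear f -> linear A -> linear T -> (#|I| <= #|J|)%N ->
  (forall x, exists c, A c = x) -> (forall y, exists x, f x = y) ->
  (forall d, exists y, T y = d) -> injective f.
Proof.
move=> linf linA linT.
pose f' : {linear V -> W} := HB.pack f (GRing.isLinear.Build F V W _ f linf).
pose A' : {linear {ffun I -> F^o} -> V} :=
  HB.pack A (GRing.isLinear.Build F {ffun I -> F^o} V _ A linA).
pose T' : {linear W -> {ffun J -> F^o}} :=
  HB.pack T (GRing.isLinear.Build F W {ffun J -> F^o} _ T linT).
rewrite -[f]/(f' : V -> W) -[A]/(A' : _ -> V) -[T]/(T' : W -> _).
move: f' A' T' => {f A T linf linA linT} f A T.
move=> IJ Asurj fsurj Tsurj.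
pose h := linfun (T \o f \o A).
have hsurj : limg h = fullv.
  apply/eqP; rewrite eqEsubv subvf /=; apply/subvP => d _.
  have [y <-] := Tsurj d; have [x <-] := fsurj y; have [c <-] := Asurj x.
  by have := memv_img h (memvf c); rewrite lfunE.
have h0 : lker h == 0%VS.
  rewrite -dimv_eq0 -leqn0; have := limg_ker_dim h fullv.
  have dimE (K : finType) : \dim {:{ffun K -> F^o}} = #|K|.
    by rewrite dimvf /dim /= muln1.
  by rewrite hsurj capfv !dimE => dh; rewrite -(leq_add2r #|J|) dh.
apply: raddf_inj => x fx0; have [c cx] := Asurj x; move: fx0; rewrite -cx => fc.
have /lker0P hinj := h0; suff -> : c = 0 by rewrite linear0.
by apply: hinj; rewrite linear0 lfunE /= fc linear0.
Qed.

Section ExtPair.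
Variables (F : fieldType) (k l : nat) (V : vectType F).
Definition alt_span2 (c : {ffun alt_index k V + alt_index l V -> F^o}) :
    extpow k V * extpow l V :=
  (alt_span [ffun s => c (inl s)], alt_span [ffun s => c (inr s)]).

Lemma alt_span2_linear : linear alt_span2.
Proof.
move=> a c d; rewrite /alt_span2; congr (_, _) => /=; rewrite -linearP; congr alt_span;
  by apply/ffunP => s; rewrite !ffunE.
Qed.

Lemma alt_span2_surj x : exists c, alt_span2 c = x.
Proof.
case: x => x y; have [c <-] := alt_span_surj x; have [d <-] := alt_span_surj y.
exists [ffun s => match s with inl s => c s | inr s => d s end].
by congr (_, _); congr alt_span; apply/ffunP => s; rewrite !ffunE.
Qed.
End ExtPair.

(** * Octonion identities *)

(** Each identity of this part is a polynomial identity between the eight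
    coordinates of a Zorn matrix. *)
Section OctonionIdentities.
Variable F : fieldType.
Local Notation O := (octonion F).
Local Notation one := (oone F).
Local Notation q := (@opolar F).

Let i0 : 'I_3 := 0.
Let i1 : 'I_3 := 1.
Let i2 : 'I_3 := 2%:R.
Local Notation A a := (oct_al a).
Local Notation U a i := (oct_u a 0 i).
Local Notation V a i := (oct_v a 0 i).
Local Notation B a := (oct_be a).

Let big_ord3 (W : nmodType) (f : 'I_3 -> W) : \sum_i f i = f i0 + f i1 + f i2.
Proof.
rewrite !big_ord_recl big_ord0 addr0 addrA.
by congr (f _ + f _ + f _); apply: val_inj.
Qed.

Let dot3E (u v : 'rV[F]_3) :
  dot3 u v = u 0 i0 * v 0 i0 + u 0 i1 * v 0 i1 + u 0 i2 * v 0 i2.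
Proof. by rewrite /dot3 big_ord3. Qed.

Let cross3E (u v : 'rV[F]_3) :
  [/\ cross3 u v 0 i0 = u 0 i1 * v 0 i2 - u 0 i2 * v 0 i1,
      cross3 u v 0 i1 = u 0 i2 * v 0 i0 - u 0 i0 * v 0 i2 &
      cross3 u v 0 i2 = u 0 i0 * v 0 i1 - u 0 i1 * v 0 i0].
Proof.
by rewrite !mxE; split; congr (_ * _ - _ * _); congr (_ 0 _); apply: val_inj.
Qed.

Let oct_coordP (a b : O) : A a = A b -> B a = B b ->
  U a i0 = U b i0 -> U a i1 = U b i1 -> U a i2 = U b i2 ->
  V a i0 = V b i0 -> V a i1 = V b i1 -> V a i2 = V b i2 -> a = b.
Proof.
have rowP3 (u v : 'rV[F]_3) :
    u 0 i0 = v 0 i0 -> u 0 i1 = v 0 i1 -> u 0 i2 = v 0 i2 -> u = v.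
  move=> e0 e1 e2; apply/rowP => -[[|[|[|//]]] lti].
  - by rewrite (_ : Ordinal _ = i0) //; apply: val_inj.
  - by rewrite (_ : Ordinal _ = i1) //; apply: val_inj.
  - by rewrite (_ : Ordinal _ = i2) //; apply: val_inj.
by move=> *; apply: octP => //; apply: rowP3.
Qed.

Section Product.
Variables a b : O.
Let al_mul : A (omul a b) =
  A a * A b + (U a i0 * V b i0 + U a i1 * V b i1 + U a i2 * V b i2).
Proof. by rewrite -dot3E. Qed.
Let be_mul : B (omul a b) =
  B a * B b + (V a i0 * U b i0 + V a i1 * U b i1 + V a i2 * U b i2).
Proof. by rewrite -dot3E. Qed.
Let u_mul0 : U (omul a b) i0 =
  A a * U b i0 + B b * U a i0 - (V a i1 * V b i2 - V a i2 * V b i1).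
Proof. by rewrite /oct_u /=; have [<- _ _] := cross3E (oct_v a) (oct_v b); rewrite !mxE. Qed.
Let u_mul1 : U (omul a b) i1 =
  A a * U b i1 + B b * U a i1 - (V a i2 * V b i0 - V a i0 * V b i2).
Proof. by rewrite /oct_u /=; have [_ <- _] := cross3E (oct_v a) (oct_v b); rewrite !mxE. Qed.
Let u_mul2 : U (omul a b) i2 =
  A a * U b i2 + B b * U a i2 - (V a i0 * V b i1 - V a i1 * V b i0).
Proof. by rewrite /oct_u /=; have [_ _ <-] := cross3E (oct_v a) (oct_v b); rewrite !mxE. Qed.
Let v_mul0 : V (omul a b) i0 =
  A b * V a i0 + B a * V b i0 + (U a i1 * U b i2 - U a i2 * U b i1).
Proof. by rewrite /oct_v /=; have [<- _ _] := cross3E (oct_u a) (oct_u b); rewrite !mxE. Qed.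
Let v_mul1 : V (omul a b) i1 =
  A b * V a i1 + B a * V b i1 + (U a i2 * U b i0 - U a i0 * U b i2).
Proof. by rewrite /oct_v /=; have [_ <- _] := cross3E (oct_u a) (oct_u b); rewrite !mxE. Qed.
Let v_mul2 : V (omul a b) i2 =
  A b * V a i2 + B a * V b i2 + (U a i0 * U b i1 - U a i1 * U b i0).
Proof. by rewrite /oct_v /=; have [_ _ <-] := cross3E (oct_u a) (oct_u b); rewrite !mxE. Qed.
Definition omulE :=
  (al_mul, be_mul, u_mul0, u_mul1, u_mul2, v_mul0, v_mul1, v_mul2).
End Product.

Let alD (a b : O) : A (a + b) = A a + A b. Proof. by []. Qed.
Let beD (a b : O) : B (a + b) = B a + B b. Proof. by []. Qed.
Let uD (a b : O) i : U (a + b) i = U a i + U b i. Proof. exact: mxE. Qed.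
Let vD (a b : O) i : V (a + b) i = V a i + V b i. Proof. exact: mxE. Qed.
Let alN (a : O) : A (- a) = - A a. Proof. by []. Qed.
Let beN (a : O) : B (- a) = - B a. Proof. by []. Qed.
Let uN (a : O) i : U (- a) i = - U a i. Proof. exact: mxE. Qed.
Let vN (a : O) i : V (- a) i = - V a i. Proof. exact: mxE. Qed.
Let alZ c (a : O) : A (c *: a) = c * A a. Proof. by []. Qed.
Let beZ c (a : O) : B (c *: a) = c * B a. Proof. by []. Qed.
Let uZ c (a : O) i : U (c *: a) i = c * U a i. Proof. exact: mxE. Qed.
Let vZ c (a : O) i : V (c *: a) i = c * V a i. Proof. exact: mxE. Qed.
Let al1 : A one = 1. Proof. by []. Qed.
Let be1 : B one = 1. Proof. by []. Qed.
Let u1 i : U one i = 0. Proof. exact: mxE. Qed.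
Let v1 i : V one i = 0. Proof. exact: mxE. Qed.
Let linE :=
  (alD, beD, uD, vD, alN, beN, uN, vN, alZ, beZ, uZ, vZ, al1, be1, u1, v1).

Let normE (a : O) :
  onorm a = A a * B a - (U a i0 * V a i0 + U a i1 * V a i1 + U a i2 * V a i2).
Proof. by rewrite /onorm dot3E. Qed.
Let polarE (a b : O) : q a b = A a * B b + A b * B a
  - (U a i0 * V b i0 + U a i1 * V b i1 + U a i2 * V b i2)
  - (U b i0 * V a i0 + U b i1 * V a i1 + U b i2 * V a i2).
Proof. by rewrite opolarE !dot3E. Qed.

Lemma moufang_left (a x y : O) :
  omul a (omul x (omul a y)) = omul (omul a (omul x a)) y.
Proof. by apply: oct_coordP; rewrite !omulE; ring. Qed.

Lemma moufang_right (a x y : O) :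
  omul (omul (omul y a) x) a = omul y (omul a (omul x a)).
Proof. by apply: oct_coordP; rewrite !omulE; ring. Qed.

Lemma moufang_middle (a x y : O) :
  omul (omul a x) (omul y a) = omul a (omul (omul x y) a).
Proof. by apply: oct_coordP; rewrite !omulE; ring. Qed.

Lemma omul_flex (a x : O) : omul a (omul x a) = omul (omul a x) a.
Proof. by apply: oct_coordP; rewrite !omulE; ring. Qed.

Lemma osqr (a : O) : omul a a = otr a *: a - onorm a *: one.
Proof. by apply: oct_coordP; rewrite !linE !omulE /otr normE; ring. Qed.

Lemma omul_adj (z a b : O) : q (omul z a) b + q a (omul z b) = otr z * q a b.
Proof. by rewrite !polarE !omulE /otr; ring. Qed.

Lemma otr_mul (a b : O) : otr (omul a b) = otr a * otr b - q a b.
Proof. by rewrite polarE /otr !omulE; ring. Qed.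

Definition oconj (a : O) : O := otr a *: one - a.

Lemma oconjN (a : O) : oconj (- a) = - oconj a.
Proof. by rewrite /oconj otrN scaleNr opprB opprK addrC. Qed.

Lemma oconjK (a : O) : oconj (oconj a) = a.
Proof. by rewrite /oconj; apply: oct_coordP; rewrite !linE /otr !linE; ring. Qed.

Lemma oconjM (a b : O) : oconj (omul a b) = omul (oconj b) (oconj a).
Proof. by apply: oct_coordP; rewrite ?(linE, omulE) /otr ?(linE, omulE); ring. Qed.

Lemma onorm_conj (a : O) : onorm (oconj a) = onorm a.
Proof. by rewrite !normE !linE /otr; ring. Qed.

Lemma omul_conj_mulK (a y : O) : omul (oconj a) (omul a y) = onorm a *: y.
Proof. by apply: oct_coordP; rewrite ?(linE, omulE) normE /otr; ring. Qed.

Lemma omul_mul_conjK (a y : O) : omul (omul y a) (oconj a) = onorm a *: y.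
Proof. by apply: oct_coordP; rewrite ?(linE, omulE) normE /otr; ring. Qed.

Lemma omul_conjl (a x : O) :
  onorm a *: x - q x a *: a = - omul a (omul (oconj x) a).
Proof. by apply: oct_coordP; rewrite ?(linE, omulE) normE polarE /otr; ring. Qed.

Definition zorn_h : O := mkoct 1 0 0 (-1).
Definition zorn_u i : O := mkoct 0 (delta_mx 0 i) 0 0.
Definition zorn_v i : O := mkoct 0 0 (delta_mx 0 i) 0.

Lemma zorn_h_oct0 : zorn_h \in oct0 F.
Proof. by rewrite mem_oct0 /otr subrr. Qed.
Lemma zorn_u_oct0 i : zorn_u i \in oct0 F.
Proof. by rewrite mem_oct0 /otr addr0. Qed.
Lemma zorn_v_oct0 i : zorn_v i \in oct0 F.
Proof. by rewrite mem_oct0 /otr addr0. Qed.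

Local Notation coords z a u0 u1 u2 v0 v1 v2 b :=
  ((A z = a) * (U z i0 = u0) * (U z i1 = u1) * (U z i2 = u2) *
   (V z i0 = v0) * (V z i1 = v1) * (V z i2 = v2) * (B z = b))%type.

Let h_coords : coords zorn_h 1 0 0 0 0 0 0 (-1). Proof. by rewrite !mxE. Qed.
Let u0_coords : coords (zorn_u i0) 0 1 0 0 0 0 0 0. Proof. by rewrite !mxE. Qed.
Let u1_coords : coords (zorn_u i1) 0 0 1 0 0 0 0 0. Proof. by rewrite !mxE. Qed.
Let u2_coords : coords (zorn_u i2) 0 0 0 1 0 0 0 0. Proof. by rewrite !mxE. Qed.
Let v0_coords : coords (zorn_v i0) 0 0 0 0 1 0 0 0. Proof. by rewrite !mxE. Qed.
Let v1_coords : coords (zorn_v i1) 0 0 0 0 0 1 0 0. Proof. by rewrite !mxE. Qed.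
Let v2_coords : coords (zorn_v i2) 0 0 0 0 0 0 1 0. Proof. by rewrite !mxE. Qed.

Section ZornProduct.
Variable y : O.
Let h_mul : coords (omul zorn_h y)
  (A y) (U y i0) (U y i1) (U y i2) (- V y i0) (- V y i1) (- V y i2) (- B y).
Proof. by do !split; rewrite !omulE !h_coords; ring. Qed.
Let u0_mul : coords (omul (zorn_u i0) y)
  (V y i0) (B y) 0 0 0 (- U y i2) (U y i1) 0.
Proof. by do !split; rewrite !omulE !u0_coords; ring. Qed.
Let u1_mul : coords (omul (zorn_u i1) y)
  (V y i1) 0 (B y) 0 (U y i2) 0 (- U y i0) 0.
Proof. by do !split; rewrite !omulE !u1_coords; ring. Qed.
Let u2_mul : coords (omul (zorn_u i2) y)
  (V y i2) 0 0 (B y) (- U y i1) (U y i0) 0 0.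
Proof. by do !split; rewrite !omulE !u2_coords; ring. Qed.
Let v0_mul : coords (omul (zorn_v i0) y)
  0 0 (V y i2) (- V y i1) (A y) 0 0 (U y i0).
Proof. by do !split; rewrite !omulE !v0_coords; ring. Qed.
Let v1_mul : coords (omul (zorn_v i1) y)
  0 (- V y i2) 0 (V y i0) 0 (A y) 0 (U y i1).
Proof. by do !split; rewrite !omulE !v1_coords; ring. Qed.
Let v2_mul : coords (omul (zorn_v i2) y)
  0 (V y i1) (- V y i0) 0 0 0 (A y) (U y i2).
Proof. by do !split; rewrite !omulE !v2_coords; ring. Qed.
Definition zorn_mulE := (h_mul, u0_mul, u1_mul, u2_mul, v0_mul, v1_mul, v2_mul).
End ZornProduct.

(** The right-hand side comes from the 3-form invariant under the automorphisms
    of the octonions: the product of the three operators L_h, L_(u i), L_(v i)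
    is corrected by a multiple of L_h because [zorn_u i] and [zorn_v i] are not
    orthogonal.  The operator obtained, the identity added, has rank one. *)
Lemma zorn_3form (x : O) :
  4 *: (otr x *: one) =
    2 *: \sum_i omul zorn_h (omul (zorn_u i) (omul (zorn_v i) x))
    - 3 *: omul zorn_h x + x
    + 4 *: omul (zorn_u 0) (omul (zorn_u 1) (omul (zorn_u 2%:R) x))
    - 4 *: omul (zorn_v 0) (omul (zorn_v 1) (omul (zorn_v 2%:R) x)).
Proof.
rewrite big_ord3 -/i0 -/i1 -/i2; have zE y := zorn_mulE y.
(* Abstracting the seven multiplications keeps their coordinates folded. *)
move: (omul zorn_h) (omul (zorn_u i0)) (omul (zorn_u i1)) (omul (zorn_u i2))
  (omul (zorn_v i0)) (omul (zorn_v i1)) (omul (zorn_v i2)) zE.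
move=> h p0 p1 p2 r0 r1 r2 zE.
by apply: oct_coordP; rewrite !linE ?zE /otr; ring.
Qed.

Let polar_h (x : O) : q x zorn_h = B x - A x.
Proof. by rewrite polarE !h_coords; ring. Qed.
Let dot3C (u v : 'rV[F]_3) : dot3 u v = dot3 v u.
Proof. by rewrite !dot3E; ring. Qed.
Let dot3_unit (w : 'rV[F]_3) i : dot3 w (delta_mx 0 i) = w 0 i.
Proof.
rewrite /dot3 (bigD1 i) //= big1 => [|k /negPf ki]; rewrite mxE ?ki ?andbF ?mulr0 //.
by rewrite !eqxx mulr1 addr0.
Qed.
Let dot3_0r (w : 'rV[F]_3) : dot3 w 0 = 0.
Proof. by rewrite dot3E !mxE; ring. Qed.
Let polar_u (x : O) i : q x (zorn_u i) = - V x i.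
Proof.
rewrite opolarE [dot3 _ (oct_v x)]dot3C dot3_unit dot3_0r.
by rewrite (_ : A (zorn_u i) = 0) // (_ : B (zorn_u i) = 0) //; ring.
Qed.
Let polar_v (x : O) i : q x (zorn_v i) = - U x i.
Proof.
rewrite opolarE dot3_unit [dot3 _ (oct_v x)]dot3C dot3_0r.
by rewrite (_ : A (zorn_v i) = 0) // (_ : B (zorn_v i) = 0) //; ring.
Qed.
Let polar_zornE :=
  (opolarDr, opolarNr, opolarZr, opolar1, polar_h, polar_u, polar_v).

Section OrthonormalBasis.
#[local] Arguments oct_be _ _ : simpl never.
Variable j : F.
Hypothesis jj : j * j = -1.

Definition orthonormal_seq : 8.-tuple O :=
  [tuple one; j *: zorn_h;
         zorn_u 0 - zorn_v 0; zorn_u 1 - zorn_v 1; zorn_u 2%:R - zorn_v 2%:R;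
         j *: (zorn_u 0 + zorn_v 0); j *: (zorn_u 1 + zorn_v 1);
         j *: (zorn_u 2%:R + zorn_v 2%:R)].

Lemma orthonormal_expand (x : O) :
  2 *: x = \sum_i q x (tnth orthonormal_seq i) *: tnth orthonormal_seq i.
Proof.
rewrite !big_ord_recl big_ord0 addr0 !(tnth_nth 0) /= -/i0 -/i1 -/i2 !polar_zornE.
move: h_coords u0_coords u1_coords u2_coords v0_coords v1_coords v2_coords.
move: zorn_h (zorn_u i0) (zorn_u i1) (zorn_u i2) (zorn_v i0) (zorn_v i1) (zorn_v i2).
move=> h p0 p1 p2 r0 r1 r2 hE p0E p1E p2E r0E r1E r2E.
apply: oct_coordP; rewrite !linE;
  by rewrite ?(hE, p0E, p1E, p2E, r0E, r1E, r2E) /otr; ring: jj.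
Qed.

Lemma orthonormal_polar i k :
  q (tnth orthonormal_seq i) (tnth orthonormal_seq k) = 2 * (i == k)%:R.
Proof.
rewrite !(tnth_nth 0) /= -/i0 -/i1 -/i2 -val_eqE.
have -> (x : O) : q x orthonormal_seq`_k = [:: otr x; j * (B x - A x);
    U x i0 - V x i0; U x i1 - V x i1; U x i2 - V x i2;
    - j * (U x i0 + V x i0); - j * (U x i1 + V x i1); - j * (U x i2 + V x i2)]`_k.
  case: k => [[|[|[|[|[|[|[|[|//]]]]]]]] ?];
    by rewrite /= -/i0 -/i1 -/i2 !polar_zornE //; ring.
move: h_coords u0_coords u1_coords u2_coords v0_coords v1_coords v2_coords.
move: zorn_h (zorn_u i0) (zorn_u i1) (zorn_u i2) (zorn_v i0) (zorn_v i1) (zorn_v i2).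
move=> h p0 p1 p2 r0 r1 r2 hE p0E p1E p2E r0E r1E r2E.
case: i => [[|[|[|[|[|[|[|[|//]]]]]]]] ?] /=;
  rewrite /otr !linE ?(hE, p0E, p1E, p2E, r0E, r1E, r2E);
  by case: k => [[|[|[|[|[|[|[|[|//]]]]]]]] ?] /=; ring: jj.
Qed.

End OrthonormalBasis.

End OctonionIdentities.

(** * Products of left multiplications *)

Section CliffordProduct.
Variables (F : fieldType) (V W : vectType F).
Local Notation E := 'End(W).

(** Named copies of composition and addition, to carry the laws by which a product
    of sums is expanded into a sum of products. *)
Definition lfun_mul : E -> E -> E := @comp_lfun _ _ _ _.
Definition lfun_add : E -> E -> E := +%R.

Lemma lfun_mulA : associative lfun_mul. Proof. exact: comp_lfunA. Qed.
Lemma lfun_mul1 : left_id \1%VF lfun_mul. Proof. exact: comp_lfun1l. Qed.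
Lemma lfun_mulr1 : right_id \1%VF lfun_mul. Proof. exact: comp_lfun1r. Qed.
HB.instance Definition _ :=
  Monoid.isLaw.Build E \1%VF lfun_mul lfun_mulA lfun_mul1 lfun_mulr1.
HB.instance Definition _ := Monoid.isMulLaw.Build E 0 lfun_mul
  (@comp_lfun0l _ _ _ _) (@comp_lfun0r _ _ _ _).
HB.instance Definition _ :=
  Monoid.isComLaw.Build E 0 lfun_add (@addrA _) (@addrC _) (@add0r _).
HB.instance Definition _ := Monoid.isAddLaw.Build E lfun_mul lfun_add
  (@comp_lfunDl _ _ _ _) (@comp_lfunDr _ _ _ _).

Definition opprod k (T : 'I_k -> E) : E := \big[lfun_mul / \1%VF]_j T j.

Lemma opprodZ k (c : 'I_k -> F) (T : 'I_k -> E) :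
  opprod (fun j => c j *: T j) = (\prod_j c j) *: opprod T.
Proof.
rewrite /opprod; apply: (big_rec3 (fun x y z => z = x *: y)); first by rewrite scale1r.
by move=> j x y _ _ ->; rewrite /lfun_mul -comp_lfunZr -comp_lfunZl scalerA mulrC.
Qed.

Lemma opprod_tprod (L : V -> E) k (v : 'I_k -> V) : linear L ->
  opprod (fun j => L (v j)) =
  \sum_i (tprod v i : F) *: opprod (fun j => L (vbasis {:V})`_(i j)).
Proof.
move=> linL; pose L' : {linear V -> E} := HB.pack L (GRing.isLinear.Build F V E _ L linL).
transitivity (\big[lfun_mul / \1%VF]_(j < k) \big[lfun_add/0]_n
    (coord (vbasis {:V}) n (v j) *: L (vbasis {:V})`_n)).
  apply: eq_bigr => j _; rewrite -[L]/(L' : V -> E) {1}(coord_vbasis (memvf (v j))) linear_sum.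
  by apply: eq_bigr => n _; rewrite linearZ.
rewrite (bigA_distr_bigA (fun j n => coord (vbasis {:V}) n (v j) *: L (vbasis {:V})`_n)).
by apply: eq_bigr => i _; rewrite ffunE -opprodZ.
Qed.

Lemma opprod3 (T : 'I_3 -> E) :
  opprod T = (T 0 \o (T 1 \o T 2%:R))%VF.
Proof.
rewrite /opprod !big_ord_recl big_ord0 /lfun_mul comp_lfun1r.
by congr (T _ \o (T _ \o T _))%VF; apply: val_inj.
Qed.

Lemma opprod_intertwine k (T S : 'I_k -> E) (B : E) :
  (forall j, S j \o B = B \o T j)%VF -> (opprod S \o B = B \o opprod T)%VF.
Proof.
move=> TS; apply: (big_rec2 (fun x y => (x \o B = B \o y)%VF)).
  by rewrite comp_lfun1l comp_lfun1r.
by move=> j y x _ IH; rewrite /lfun_mul -comp_lfunA IH !comp_lfunA TS.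
Qed.

End CliffordProduct.

(** * The Casimir contraction *)

Section Casimir.
Variables (F : fieldType) (V : vectType F) (I : finType) (e : I -> V).
Variable q : V -> V -> F.
Hypothesis F2 : 2 != 0 :> F.
Hypothesis qC : forall x y, q x y = q y x.
Hypothesis e_expand : forall x : V, 2 *: x = \sum_i q x (e i) *: e i.

(** Up to the factor 2 in [e_expand], the image of [T] under the identification of
    operators with tensors that [q] gives, followed by symmetrization. *)
Definition casimir (T : 'End(V)) : sympow 2 V := \sum_i sprod (T (e i)) (e i).

Lemma casimir_linear : linear casimir.
Proof.
move=> a T S; rewrite /casimir scaler_sumr -big_split; apply: eq_bigr => i _ /=.
by rewrite add_lfunE scale_lfunE sprodDl sprodZl.
Qed.
HB.instance Definition _ := GRing.isLinear.Build F _ _ _ casimir casimir_linear.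

(** Moving [S] across the contraction: expand both S (e i) and S' (e j) in the
    family [e]; the coefficients agree. *)
Lemma casimir_adj (A C S S' : 'End(V)) :
  (forall a b, q (S a) b = q a (S' b)) ->
  \sum_i sprod (A (S (e i))) (C (e i)) = \sum_i sprod (A (e i)) (C (S' (e i))).
Proof.
move=> SS'; apply: (scalerI F2); rewrite !scaler_sumr.
transitivity (\sum_i \sum_j q (S (e i)) (e j) *: sprod (A (e j)) (C (e i))).
  apply: eq_bigr => i _; rewrite -sprodZl -linearZ e_expand linear_sum sprod_suml.
  by apply: eq_bigr => j _; rewrite linearZ_LR sprodZl.
rewrite exchange_big; apply: eq_bigr => j _ /=.
rewrite -sprodZr -linearZ e_expand !linear_sum; apply: eq_bigr => i _.
by rewrite !linearZ_LR /= SS' qC.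
Qed.

Lemma casimir_skew (T : 'End(V)) :
  (forall a b, q (T a) b = q a ((- T) b)) -> casimir T = 0.
Proof.
move=> Tskew; have := casimir_adj \1 \1 Tskew.
under eq_bigr do rewrite !id_lfunE; under [RHS]eq_bigr do rewrite !id_lfunE sprodC.
rewrite -!/(casimir _) linearN => /eqP; rewrite -addr_eq0 -mulr2n -scaler_nat.
by rewrite scaler_eq0 (negPf F2) => /eqP.
Qed.

(** The adjoint of an isometry is its inverse, so the contraction does not change
    when [e] is replaced by its image under [B]. *)
Lemma smap_casimir (B T T' : 'End(V)) :
  lker B == 0%VS -> (forall a b, q (B a) (B b) = q a b) ->
  (T' \o B = B \o T)%VF -> smap B (casimir T) = casimir T'.
Proof.
move=> B0 Bq TB; rewrite /casimir linear_sum.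
transitivity (\sum_i sprod (T' (B (e i))) (B (e i))).
  by apply: eq_bigr => i _; rewrite /= smap_sprod -!comp_lfunE TB.
rewrite (casimir_adj T' B (S := B) (S' := (B^-1)%VF)).
  by apply: eq_bigr => i _; rewrite lker0_lfunVK.
by move=> a b; rewrite -[in RHS]Bq lker0_lfunVK.
Qed.

End Casimir.

Section Multiplications.
Variable F : fieldType.
Local Notation O := (octonion F).

Lemma lmulE (x y : O) : lmul x y = omul x y. Proof. by rewrite lfunE. Qed.
Lemma rmulE (x y : O) : rmul x y = omul y x. Proof. by rewrite lfunE. Qed.

Definition mkSO8 (g : 'End(O)) (gso : g \in @so8 F) : SO8 F :=
  exist (fun g => g \in @so8 F) g gso.

End Multiplications.

Section OctonionCasimir.
Variables (F : fieldType) (e : 'I_8 -> octonion F).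
Local Notation O := (octonion F).
Local Notation one := (oone F).
Local Notation q := (@opolar F).
Local Notation O0 := (subvs_of (oct0 F)).
Hypothesis F2 : 2 != 0 :> F.
Hypothesis e_expand : forall x : O, 2 *: x = \sum_i q x (e i) *: e i.
Local Notation casimir := (casimir e).

Lemma lmul_linear : linear (@lmul F).
Proof.
move=> c y z; apply/lfunP => a; rewrite add_lfunE scale_lfunE !lfunE /=.
exact: (linearP (omulr a)).
Qed.

Lemma lmul_skew (z a b : O) : z \in oct0 F -> q (omul z a) b = - q a (omul z b).
Proof.
by rewrite mem_oct0 => /eqP z0; apply/eqP; rewrite -addr_eq0 omul_adj z0 mul0r.
Qed.

Lemma casimir_lmul (z : O) : z \in oct0 F -> casimir (lmul z) = 0.
Proof.
move=> z0; apply: (casimir_skew F2 (@opolarC F) e_expand) => a b.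
by rewrite opp_lfunE opolarNr !lmulE lmul_skew.
Qed.

Lemma omul_sqr (z y : O) : z \in oct0 F -> omul z (omul z y) = - onorm z *: y.
Proof.
rewrite mem_oct0 => /eqP z0; rewrite omul_altl osqr z0 scale0r sub0r -scaleNr.
by rewrite -[LHS]/(omulr y (- onorm z *: one)) linearZ_LR /= /omulr omul1o.
Qed.

Lemma lmul_sqr (z : O) : z \in oct0 F -> (lmul z \o lmul z = (- onorm z) *: \1)%VF.
Proof.
by move=> z0; apply/lfunP => y; rewrite comp_lfunE !lmulE scale_lfunE id_lfunE omul_sqr.
Qed.

(** If two of the factors are equal, the product is a multiple of some [lmul w]
    with [w] traceless: for equal neighbours because x (x y) = - n(x) y, and for
    equal ends because L_x L_y L_x is the multiplication by x (y x), by the left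
    Moufang identity. *)
Lemma casimir_alt3 (x y z : O) : x \in oct0 F -> y \in oct0 F -> z \in oct0 F ->
  [|| x == y, y == z | x == z] -> casimir (lmul x \o (lmul y \o lmul z))%VF = 0.
Proof.
move=> x0 y0 z0 /or3P[] /eqP E; move: x0 y0 z0.
- rewrite -E => x0 _ z0; rewrite comp_lfunA lmul_sqr // -comp_lfunZl comp_lfun1l.
  by rewrite linearZ /= casimir_lmul ?scaler0.
- rewrite -E => x0 y0 _; rewrite lmul_sqr // -comp_lfunZr comp_lfun1r.
  by rewrite linearZ /= casimir_lmul ?scaler0.
rewrite -E => x0 y0 _.
have -> : (lmul x \o (lmul y \o lmul x))%VF = lmul (omul x (omul y x)).
  by apply/lfunP => a; rewrite !comp_lfunE !lmulE moufang_left.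
apply: casimir_lmul; move: x0 y0; rewrite !mem_oct0 => /eqP x0 /eqP y0.
have x0' : x \in oct0 F by rewrite mem_oct0 x0.
rewrite omul_flex otr_mul x0 mulr0 sub0r lmul_skew // opprK osqr x0 scale0r sub0r.
by rewrite opolarNr opolarZr opolar1 y0 mulr0 oppr0.
Qed.

(** * From exterior powers to the symmetric square *)

Section ExteriorToSymmetric.
Variable k : nat.

Definition cliff (v : 'I_k -> O0) : 'End(O) := opprod (fun j => lmul (vsval (v j))).

Definition cliff_tensor (t : tpow k O0) : sympow 2 O :=
  \sum_i (t i : F) *: casimir (cliff (fun j => (vbasis {:O0})`_(i j))).

Lemma cliff_tensor_linear : linear cliff_tensor.
Proof.
move=> a t u; rewrite /cliff_tensor scaler_sumr -big_split; apply: eq_bigr => i _ /=.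
by rewrite scalerA -scalerDl -tpowZE; congr (_ *: _); apply: ffunE.
Qed.
HB.instance Definition _ :=
  GRing.isLinear.Build F _ _ _ cliff_tensor cliff_tensor_linear.

Lemma cliff_tensor_tprod v : cliff_tensor (tprod v) = casimir (cliff v).
Proof.
rewrite /cliff (opprod_tprod (L := @lmul F \o vsval)) => [|a x y /=]; last first.
  by rewrite lmul_linear.
by rewrite linear_sum; apply: eq_bigr => i _; rewrite linearZ.
Qed.

Hypothesis alt : forall (v : 'I_k -> O0) i j,
  i != j -> v i = v j -> casimir (cliff v) = 0.

Lemma cliff_tensor_alt t : alt_rel t -> cliff_tensor t = 0.
Proof. by move=> [v [i [j [ij vij ->]]]]; rewrite cliff_tensor_tprod (alt ij). Qed.

Definition ext_sym : extpow k O0 -> sympow 2 O := qlift cliff_tensor_alt.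
HB.instance Definition _ := GRing.Linear.copy ext_sym (qlift cliff_tensor_alt).

Lemma ext_sym_wedge v : ext_sym (wedge v) = casimir (cliff v).
Proof. by rewrite /ext_sym qlift_pi /= cliff_tensor_tprod. Qed.

(** The pair (g, B) transports the Clifford products: L_(g x) B = B L_x. *)
Lemma ext_sym_equiv (g : SO7 F) (B : 'End(O)) (w : extpow k O0) :
  B \in @so8 F -> (forall x y, omul (sval (sval g) x) (B y) = B (omul x y)) ->
  ext_sym (SO7_ext g w) = smap B (ext_sym w).
Proof.
move=> Bso gB; have /so8P[Bq _] := Bso.
apply: (extpow_ind (P := fun w => ext_sym (SO7_ext g w) = smap B (ext_sym w))).
- by rewrite /SO7_ext !linear0.
- by move=> a u v; rewrite /SO7_ext => hu hv; rewrite !linearP /= hu hv.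
move=> i; rewrite /SO7_ext emap_wedge !ext_sym_wedge; apply/esym.
apply: (smap_casimir F2 (@opolarC F) e_expand) => //; first exact: so8_lker0.
apply: opprod_intertwine => j; apply/lfunP => y.
by rewrite !comp_lfunE !lmulE /= oct0_resE gB.
Qed.

End ExteriorToSymmetric.

End OctonionCasimir.

(** * Surjectivity *)

Lemma closed_sqrt (F : closedFieldType) (c : F) : exists y : F, y * y = c.
Proof.
have [y] := @solve_monicpoly F 2 (nth 0 [:: c]) isT.
rewrite !big_ord_recl big_ord0 /= mulr1 mul0r !addr0 expr2 => yy.
by exists y.
Qed.

(** The triple (L_a R_a, L_a^-1, L_a) with a traceless of norm 1, hence a^-1 = - a,
    becomes after a change of sign a pair whose first member fixes 1. *)
Lemma conj_SO7 (F : fieldType) (a : octonion F) : 2 != 0 :> F ->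
  a \in oct0 F -> onorm a = 1 ->
  exists g : SO7 F, forall x y, omul (sval (sval g) x) (omul a y) = omul a (omul x y).
Proof.
move=> F2 a0 na; have aa y : omul a (omul a y) = - y.
  by rewrite omul_sqr // na scaleN1r.
pose g : SO8 F := SO8_opp (mkSO8 (lmul_so8 F2 na) * mkSO8 (rmul_so8 F2 na))%g.
have gE x : sval g x = - omul a (omul x a).
  by rewrite opp_lfunE comp_lfunE lmulE lfunE.
have g1 : sval g (oone F) == oone F.
  by rewrite gE omul1o -[a in omul _ a]omulo1 aa opprK.
exists (exist (fun g : SO8 F => sval g (oone F) == oone F) g g1) => x y /=.
rewrite gE -[LHS]/(omulr (omul a y) (- omul a (omul x a))) linearN /= /omulr.
by rewrite -moufang_left aa !linearN opprK.
Qed.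

Section Surjectivity.
Variable F : closedFieldType.
Local Notation O := (octonion F).
Local Notation one := (oone F).
Local Notation q := (@opolar F).
Local Notation O0 := (subvs_of (oct0 F)).
Variable e : 'I_8 -> O.
Hypothesis F2 : 2 != 0 :> F.
Hypothesis e_one : e ord0 = one.
Hypothesis e_expand : forall x : O, 2 *: x = \sum_i q x (e i) *: e i.
Hypothesis e_polar : forall i k, q (e i) (e k) = 2 * (i == k)%:R.

Lemma alt0 (v : 'I_0 -> O0) i j : i != j -> v i = v j -> casimir e (cliff v) = 0.
Proof. by case: i. Qed.

Lemma alt3 (v : 'I_3 -> O0) i j : i != j -> v i = v j -> casimir e (cliff v) = 0.
Proof.
move=> ij vij; rewrite /cliff opprod3; apply: casimir_alt3; rewrite ?subvsP //.
have vE k l : v k = v l -> vsval (v k) == vsval (v l) by move->.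
have ordE (k : 'I_3) : [\/ k = 0, k = 1 | k = 2%:R].
  by case: k => [[|[|[|//]]] ?]; [apply: Or31|apply: Or32|apply: Or33]; apply: val_inj.
by move: ij vij; case: (ordE i) => ->; case: (ordE j) => ->; rewrite ?eqxx // => _ vij;
  rewrite ?(vE _ _ vij) ?(vE _ _ (esym vij)) ?orbT.
Qed.

Definition ext03_sym (x : extpow 0 O0 * extpow 3 O0) : sympow 2 O :=
  ext_sym alt0 x.1 + ext_sym alt3 x.2.

Lemma ext03_sym_linear : linear ext03_sym.
Proof. by move=> a x y; rewrite /ext03_sym !linearP /= scalerDr addrACA. Qed.

Lemma ext03_sym_equiv (g : SO7 F) (B : 'End(O)) x :
  B \in @so8 F -> (forall x y, omul (sval (sval g) x) (B y) = B (omul x y)) ->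
  ext03_sym (act_sum (@SO7_ext F 0) (@SO7_ext F 3) g x) = smap B (ext03_sym x).
Proof.
by move=> Bso gB; rewrite /ext03_sym /= !(ext_sym_equiv F2 e_expand _ _ Bso gB) linearD.
Qed.

Definition in_im (y : sympow 2 O) := exists x, ext03_sym x = y.

Lemma in_imP a y z : in_im y -> in_im z -> in_im (a *: y + z).
Proof. by move=> [x <-] [w <-]; exists (a *: x + w); rewrite ext03_sym_linear. Qed.
Lemma in_im0 : in_im 0.
Proof. by exists (0 + -1 *: 0); rewrite addrC ext03_sym_linear scaleN1r addNr. Qed.
Lemma in_imZ a y : in_im y -> in_im (a *: y).
Proof. by move=> Wy; rewrite -[_ *: _]addr0; apply: in_imP => //; apply: in_im0. Qed.
Lemma in_imD y z : in_im y -> in_im z -> in_im (y + z).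
Proof. by move=> Wy Wz; rewrite -[y]scale1r; apply: in_imP. Qed.
Lemma in_im_sum (I : finType) (f : I -> sympow 2 O) :
  (forall i, in_im (f i)) -> in_im (\sum_i f i).
Proof. by move=> Wf; apply: (big_ind in_im) => // [|y z]; [apply: in_im0|apply: in_imD]. Qed.
Lemma in_imK a y : a != 0 -> in_im (a *: y) -> in_im y.
Proof. by move=> a0 /(in_imZ a^-1); rewrite scalerA mulVf // scale1r. Qed.

Lemma in_im_id : in_im (casimir e \1%VF).
Proof.
exists (wedge (fun _ : 'I_0 => 0), 0); rewrite /ext03_sym /= linear0 addr0 ext_sym_wedge.
by rewrite /cliff /opprod big_ord0.
Qed.

Lemma in_im_lmul3 x y z : x \in oct0 F -> y \in oct0 F -> z \in oct0 F ->
  in_im (casimir e (lmul x \o (lmul y \o lmul z))%VF).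
Proof.
move=> x0 y0 z0; pose v (j : 'I_3) := vsproj (oct0 F) (tnth [tuple x; y; z] j).
exists (0, wedge v); rewrite /ext03_sym /= linear0 add0r ext_sym_wedge /cliff opprod3.
by rewrite /v !vsprojK.
Qed.

(** The contraction of x |-> tr(x) 1 = q(x, 1) 1 is 2 (1 . 1).  By [zorn_3form] this
    operator is a combination of the identity, of products L_x L_y L_z and of L_h,
    and the contraction kills L_h. *)
Lemma in_im_one : in_im (sprod one one).
Proof.
pose c3 x y z := \sum_i sprod (omul x (omul y (omul z (e i)))) (e i).
have c3P x y z : x \in oct0 F -> y \in oct0 F -> z \in oct0 F -> in_im (c3 x y z).
  move=> x0 y0 z0; have := in_im_lmul3 x0 y0 z0; congr in_im.
  by apply: eq_bigr => i _; rewrite !comp_lfunE !lmulE.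
have hP := zorn_h_oct0 F; have uP := zorn_u_oct0 F; have vP := zorn_v_oct0 F.
apply: (@in_imK 8); first by rewrite (natrM _ 2 4) (natrM _ 2 2) !mulf_neq0.
have -> : 8 *: sprod one one = 2 *: (\sum_k c3 (zorn_h F) (zorn_u F k) (zorn_v F k))
    + - 3 *: casimir e (lmul (zorn_h F)) + casimir e \1%VF
    + 4 *: c3 (zorn_u F 0) (zorn_u F 1) (zorn_u F 2%:R)
    + - 4 *: c3 (zorn_v F 0) (zorn_v F 1) (zorn_v F 2%:R).
  transitivity (4 *: sprod one (\sum_i q one (e i) *: e i)).
    by rewrite -e_expand sprodZr scalerA -natrM.
  rewrite /c3 exchange_big /= !scaler_sumr -!big_split linear_sum scaler_sumr.
  apply: eq_bigr => i _ /=.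
  transitivity (sprod (4 *: (otr (e i) *: one)) (e i)).
    by rewrite !sprodZl sprodZr -opolar1 opolarC.
  by rewrite zorn_3form -!scaleNr !sprodDl !sprodZl sprod_suml lmulE id_lfunE.
rewrite (casimir_lmul F2 e_expand hP) scaler0 addr0.
apply: in_imD; last by apply/in_imZ/c3P.
apply: in_imD; last by apply/in_imZ/c3P.
apply: in_imD; last exact: in_im_id.
by apply/in_imZ/in_im_sum => k; apply: c3P.
Qed.

Lemma in_im_lmul a y : a \in oct0 F -> onorm a = 1 ->
  in_im y -> in_im (smap (lmul a) y).
Proof.
move=> a0 na [x <-]; have [g gP] := conj_SO7 F2 a0 na.
exists (act_sum (@SO7_ext F 0) (@SO7_ext F 3) g x); apply: ext03_sym_equiv.
  exact: lmul_so8.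
by move=> z w; rewrite !lmulE gP.
Qed.

Lemma in_im_sqr a : a \in oct0 F -> onorm a = 1 -> in_im (sprod a a).
Proof.
move=> a0 na; have := in_im_lmul a0 na in_im_one.
by rewrite smap_sprod !lmulE omulo1.
Qed.

Lemma onorm_e i : onorm (e i) = 1.
Proof. by apply: (mulfI F2); rewrite -opolarxx e_polar eqxx. Qed.

Lemma e_oct0 i : i != ord0 -> e i \in oct0 F.
Proof. by move=> /negPf i0; rewrite mem_oct0 -opolar1 -e_one e_polar i0 mulr0. Qed.

Lemma in_im_ee i k : i != ord0 -> k != ord0 -> in_im (sprod (e i) (e k)).
Proof.
move=> i0 k0; have [<-|ik] := eqVneq i k.
  by apply: in_im_sqr; rewrite ?e_oct0 ?onorm_e.
(* The sum of two orthogonal vectors of norm 1 has norm 2. *)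
have [r rr] := closed_sqrt (2^-1 : F).
have Wik : in_im (sprod (r *: (e i + e k)) (r *: (e i + e k))).
  apply: in_im_sqr; first by rewrite rpredZ ?rpredD ?e_oct0.
  apply: (mulfI F2); rewrite -opolarxx opolarZr opolarC opolarZr opolarDr.
  rewrite ![q (_ + _) _]opolarC !opolarDr !e_polar !eqxx [k == i]eq_sym (negPf ik).
  by rewrite mulrA rr /=; field.
have Wi := in_im_sqr (e_oct0 i0) (onorm_e i).
have Wk := in_im_sqr (e_oct0 k0) (onorm_e k).
have -> : sprod (e i) (e k) = sprod (r *: (e i + e k)) (r *: (e i + e k))
    + (- 2^-1) *: (sprod (e i) (e i) + sprod (e k) (e k)).
  rewrite sprodZl sprodZr scalerA rr sprodDl !sprodDr [sprod (e k) (e i)]sprodC.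
  rewrite scaleNr !scalerDr [2^-1 *: _ + 2^-1 *: sprod (e i) (e k)]addrC addrACA.
  have -> : 2^-1 *: sprod (e i) (e k) + 2^-1 *: sprod (e i) (e k) = sprod (e i) (e k).
    by rewrite -scalerDl (_ : 2^-1 + 2^-1 = 1) ?scale1r //; field.
  by rewrite addrK.
by apply: in_imD => //; apply/in_imZ/in_imD.
Qed.

Lemma in_im_oct0 x y : x \in oct0 F -> y \in oct0 F -> in_im (sprod x y).
Proof.
move=> x0 y0; apply: (in_imK F2); rewrite -sprodZr e_expand linear_sum.
apply: in_im_sum => i /=.
rewrite sprodZr; have [->|i0] := eqVneq i ord0.
  by move: y0; rewrite mem_oct0 e_one opolar1 => /eqP->; rewrite scale0r; apply: in_im0.
apply: in_imZ; apply: (in_imK F2); rewrite -sprodZl e_expand sprod_suml; apply: in_im_sum => k.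
rewrite sprodZl; have [->|k0] := eqVneq k ord0.
  by move: x0; rewrite mem_oct0 e_one opolar1 => /eqP->; rewrite scale0r; apply: in_im0.
by apply/in_imZ/in_im_ee.
Qed.

Lemma e_mulK k y : k != ord0 -> omul (e k) (omul (e k) y) = - y.
Proof. by move=> k0; rewrite omul_sqr ?e_oct0 // onorm_e scaleN1r. Qed.

Lemma ee_oct0 k m : k != ord0 -> k != m -> omul (e k) (e m) \in oct0 F.
Proof.
move=> /e_oct0 k0 /negPf km; move: k0; rewrite !mem_oct0 => /eqP tk.
by rewrite otr_mul tk mul0r e_polar km mulr0 subr0.
Qed.

Lemma exists_ord8 (m : 'I_8) : exists2 k : 'I_8, k != ord0 & k != m.
Proof.
have [->|m1] := eqVneq m (lift ord0 ord0); first by exists ord_max.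
by exists (lift ord0 ord0) => //; rewrite eq_sym.
Qed.

(** L_a (a . (a z)) = (a a) . (a (a z)) = 1 . z for the unit vector a = e k and
    z = e m orthogonal to it. *)
Lemma in_im_one_e m : m != ord0 -> in_im (sprod one (e m)).
Proof.
move=> m0; have [k k0 km] := exists_ord8 m.
have := in_im_lmul (e_oct0 k0) (onorm_e k) (in_im_oct0 (e_oct0 k0) (ee_oct0 k0 km)).
rewrite smap_sprod !lmulE e_mulK //; have -> : omul (e k) (e k) = - one.
  by rewrite -(e_mulK one k0) omulo1.
by rewrite sprodNN.
Qed.

Lemma ext03_sym_surj y : in_im y.
Proof.
apply: (sympow2_ind (P := in_im)) => [|a u v|x z]; [exact: in_im0 | exact: in_imP|].
apply: (in_imK F2); rewrite -sprodZr e_expand linear_sum; apply: in_im_sum => i /=.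
rewrite sprodZr; apply: in_imZ.
apply: (in_imK F2); rewrite -sprodZl e_expand sprod_suml; apply: in_im_sum => k.
rewrite sprodZl; apply: in_imZ.
have [->|i0] := eqVneq i ord0; have [->|k0] := eqVneq k ord0; rewrite ?e_one.
- exact: in_im_one.
- by rewrite sprodC; apply: in_im_one_e.
- exact: in_im_one_e.
- exact: in_im_ee.
Qed.

End Surjectivity.

(** * Injectivity *)

Section Injectivity.
Variable F : closedFieldType.
Local Notation O := (octonion F).
Local Notation one := (oone F).
Local Notation q := (@opolar F).
Local Notation O0 := (subvs_of (oct0 F)).
Variable e : 'I_8 -> O.
Hypothesis F2 : 2 != 0 :> F.
Hypothesis e_one : e ord0 = one.
Hypothesis e_expand : forall x : O, 2 *: x = \sum_i q x (e i) *: e i.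
Hypothesis e_polar : forall i k, q (e i) (e k) = 2 * (i == k)%:R.

Lemma dim_oct0 : \dim {:O0} = 7%N.
Proof.
have -> : \dim {:O0} = \dim (oct0 F) by rewrite dimvf.
pose t := linfun (@otr F : O -> F^o).
have tsurj : limg t = fullv.
  apply/eqP; rewrite eqEsubv subvf /=; apply/subvP => c _.
  have -> : c = t (mkoct c 0 0 0) by rewrite lfunE /= /otr addr0.
  by apply/memv_img/memvf.
have := limg_ker_dim t fullv.
by rewrite capfv tsurj dim_octonion [\dim {:F^o}]dimvf /= addn1 => -[].
Qed.

Lemma ext03_sym_inj : injective (ext03_sym F2 e_expand).
Proof.
apply: (@surj_inj_count F _ (sym_index O) _ _ _ (@alt_span2 F 0 3 O0) (@sympow_entries F O)).
- exact: ext03_sym_linear.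
- exact: alt_span2_linear.
- exact: qlift_linear.
- rewrite card_sum !card_alt_index card_sym_index dim_oct0.
  by rewrite [\dim _]dim_octonion.
- exact: alt_span2_surj.
- exact: ext03_sym_surj.
- by move=> d; apply: sympow_entries_surj.
Qed.

End Injectivity.

(** * Reflections *)

(** The two products of [X] and [Y] are block triangular. *)
Lemma det_sub_rank1 (R : comNzRingType) n (c : 'cV[R]_n) (r : 'rV[R]_n) :
  \det (1%:M - c *m r) = 1 - (r *m c) 0 0.
Proof.
pose X := block_mx 1%:M c r 1%:M; pose Y := block_mx 1%:M 0 (- r) (1%:M : 'M_1).
have dY : \det Y = 1 by rewrite det_lblock !det1 mulr1.
have : \det (X *m Y) = \det (Y *m X) by rewrite !det_mulmx mulrC.
rewrite /X /Y !mulmx_block !(mul1mx, mulmx1, mul0mx, mulmx0, mulNmx, mulmxN).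
rewrite !(addr0, add0r) subrr addNr !det_ublock !det1 mulr1 mul1r => ->.
by rewrite [LHS]det_mx11 addrC !mxE eqxx.
Qed.

Section Reflections.
Variable F : fieldType.
Local Notation O := (octonion F).
Local Notation one := (oone F).
Local Notation q := (@opolar F).
Hypothesis F2 : 2 != 0 :> F.

(** The reflection in the hyperplane orthogonal to [a] when [a] has norm 1. *)
Definition reflection (a x : O) : O := x - q x a *: a.
Lemma reflection_linear a : linear (reflection a).
Proof.
move=> c x y; rewrite /reflection opolarC opolarDr opolarZr scalerBr scalerDl scalerA.
by rewrite ![q a _]opolarC opprD addrACA.
Qed.
HB.instance Definition _ a :=
  GRing.isLinear.Build F O O _ (reflection a) (reflection_linear a).
Definition refl (a : O) : 'End(O) := linfun (reflection a).

Lemma onormD (x y : O) : onorm (x + y) = onorm x + onorm y + q x y.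
Proof. by rewrite /opolar; ring. Qed.

Lemma reflE a x : refl a x = x - q x a *: a. Proof. by rewrite lfunE. Qed.

Definition isom (g : 'End(O)) := forall x y, q (g x) (g y) = q x y.

Lemma isom_comp g h : isom g -> isom h -> isom (g \o h)%VF.
Proof. by move=> ig ih x y; rewrite !comp_lfunE ig ih. Qed.

Lemma isom_refl a : onorm a = 1 -> isom (refl a).
Proof.
move=> na x y; rewrite !reflE opolarDr opolarNr opolarZr ![q (_ - _) _]opolarC.
rewrite !opolarDr !opolarNr !opolarZr opolarxx na [q y x]opolarC [q a x]opolarC.
by ring.
Qed.

Lemma reflK a x : onorm a = 1 -> refl a (refl a x) = x.
Proof.
move=> na; rewrite !reflE [q (_ - _) _]opolarC opolarDr opolarNr opolarZr opolarxx na.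
rewrite [q a x]opolarC -addrA -opprD -scalerDl.
have -> : q x a + (q x a - q x a * (2 * 1)) = 0 by ring.
by rewrite scale0r subr0.
Qed.

Lemma refl_mul a x : onorm a = 1 -> refl a x = - omul a (omul (oconj x) a).
Proof. by move=> na; rewrite reflE -omul_conjl na scale1r. Qed.

(** The matrix of the reflection in 1 differs from the identity by a matrix of
    rank one and trace q(1, 1) = 2. *)
Lemma ldet_refl1 : ldet (refl one) = -1.
Proof.
rewrite /ldet; set b := vbasis _.
have bP : basis_of {:O} b := vbasisP _.
pose c : 'cV[F]_(\dim {:O}) := \col_i q b`_i one.
have -> : mxof b b (refl one) = 1%:M - c *m rVof b one.
  apply/row_matrixP => i; rewrite linearB /= row_mul row1.
  have -> : row i (mxof b b (refl one)) = rVof b (refl one b`_i).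
    by apply/rowP => l; rewrite !mxE /= vecof_delta.
  rewrite reflE linearB linearZ /= rVofE ?(basis_free bP) //; congr (_ - _).
  by apply/rowP => l; rewrite !mxE big_ord1 !mxE.
rewrite det_sub_rank1; suff -> : (rVof b one *m c) 0 0 = 2 by ring.
transitivity (q one one); last by rewrite opolarxx onorm1 mulr1.
rewrite mxE [X in _ = q _ X](coord_basis bP (memvf one)) opolar_sumr.
by apply: eq_bigr => i _; rewrite opolarZr !mxE opolarC.
Qed.

(** The reflection in a is L_a R_a composed with the reflection in 1. *)
Lemma ldet_refl a : onorm a = 1 -> ldet (refl a) = -1.
Proof.
move=> na; have -> : refl a = (lmul a \o (rmul a \o refl one))%VF.
  apply/lfunP => x; rewrite !comp_lfunE lmulE refl_mul // refl_mul ?onorm1 // lfunE /=.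
  by rewrite omul1o omulo1 !linearN.
have /so8P[_ dL] := lmul_so8 F2 na; have /so8P[_ dR] := rmul_so8 F2 na.
by rewrite !ldetM dL dR !mul1r ldet_refl1.
Qed.

Definition reflection_prod (s : seq O) : 'End(O) :=
  foldr (fun a f => (refl a \o f)%VF) \1%VF s.

Lemma isom_reflection_prod s : (forall a, a \in s -> onorm a = 1) -> isom (reflection_prod s).
Proof.
elim: s => [_ x y|a s IH sn] /=; first by rewrite !id_lfunE.
apply: isom_comp; first by apply/isom_refl/sn/mem_head.
by apply: IH => b bs; apply: sn; rewrite in_cons bs orbT.
Qed.

Lemma ldet_reflection_prod s : (forall a, a \in s -> onorm a = 1) ->
  ldet (reflection_prod s) = (-1) ^+ size s.
Proof.
elim: s => [_|a s IH sn] /=; first by rewrite ldet1.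
rewrite ldetM ldet_refl ?sn ?mem_head // IH ?exprS // => b bs.
by apply: sn; rewrite in_cons bs orbT.
Qed.

End Reflections.

Section CartanDieudonne.
Variable F : closedFieldType.
Local Notation O := (octonion F).
Local Notation q := (@opolar F).
Variable e : 'I_8 -> O.
Hypothesis F2 : 2 != 0 :> F.
Hypothesis e_expand : forall x : O, 2 *: x = \sum_i q x (e i) *: e i.
Hypothesis e_polar : forall i k, q (e i) (e k) = 2 * (i == k)%:R.

Lemma refl_swap (x y : O) : onorm x = onorm y -> onorm (x - y) != 0 ->
  exists a, [/\ onorm a = 1, refl a x = y &
    forall z, q x z = q y z -> refl a z = z].
Proof.
move=> nxy nd; have [r rr] := closed_sqrt (onorm (x - y))^-1.
have qdd : q x (x - y) = onorm (x - y).
  apply: (mulfI F2); rewrite -opolarxx ![q _ (x - y)]opolarDr !opolarNr.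
  rewrite ![q (x - y) _]opolarC !opolarDr !opolarNr !opolarxx nxy [q y x]opolarC; ring.
exists (r *: (x - y)); split.
- apply: (mulfI F2); rewrite -opolarxx opolarZr opolarC opolarZr opolarxx mulrA rr.
  by rewrite mulrCA mulVf ?mulr1.
- by rewrite reflE opolarZr scalerA -mulrA mulrCA rr qdd mulfV // scale1r subKr.
move=> z qz; rewrite reflE opolarZr opolarDr opolarNr ![q z _]opolarC qz subrr mulr0.
by rewrite scale0r subr0.
Qed.

(** The isometry is made to fix e 7, e 6, ... in turn.  With x = g (e i) and
    y = e i, one of x - y and x + y has nonzero norm, as these norms add up to 4;
    the reflection in the first takes x to y, and the reflection in the second
    followed by the one in y does too. *)
Lemma cartan_dieudonne (g : 'End(O)) : isom g ->
  exists2 s : seq O, (forall a, a \in s -> onorm a = 1) & g = reflection_prod s.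
Proof.
have one_e i : onorm (e i) = 1 by apply: (mulfI F2); rewrite -opolarxx e_polar eqxx.
suff : forall k, (k <= 8)%N -> isom g -> (forall i : 'I_8, (k <= i)%N -> g (e i) = e i) ->
    exists2 s : seq O, (forall a, a \in s -> onorm a = 1) & g = reflection_prod s.
  by move=> H ig; apply: (H 8) => // i; rewrite leqNgt ltn_ord.
move=> k; elim: k g => [|k IH] g k8 ig gfix.
  exists [::] => //=; apply/lfunP => x; apply: (scalerI F2); rewrite id_lfunE.
  rewrite -linearZ e_expand linear_sum; apply: eq_bigr => i _.
  by rewrite linearZ_LR /= gfix.
pose i := Ordinal k8.
have gi_orth (l : 'I_8) : (i < l)%N -> q (g (e i)) (e l) = 0.
  move=> il; rewrite -(gfix l il) ig e_polar -val_eqE /=.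
  by rewrite (ltn_eqF il) mulr0.
have ei_orth (l : 'I_8) : (i < l)%N -> q (e i) (e l) = 0.
  by move=> il; rewrite e_polar -val_eqE /= (ltn_eqF il) mulr0.
have ngi : onorm (g (e i)) = onorm (e i).
  by apply: (mulfI F2); rewrite -!opolarxx ig.
have step h : isom h -> (h (g (e i)) = e i) ->
    (forall l : 'I_8, (i < l)%N -> h (e l) = e l) ->
    exists2 s : seq O, (forall a, a \in s -> onorm a = 1) & (h \o g)%VF = reflection_prod s.
  move=> ih hi hl; apply: IH; [exact: ltnW | exact: isom_comp|].
  move=> l; rewrite leq_eqVlt => /orP[/eqP kl|kl]; rewrite comp_lfunE.
    by rewrite (_ : l = i) //; apply: val_inj.
  by rewrite gfix // hl.
have [n0|nd] := eqVneq (onorm (g (e i) - e i)) 0; last first.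
  have [a [na ai az]] := refl_swap ngi nd.
  have [l il|s sn sE] := step (refl a) (isom_refl na) ai.
    by apply: az; rewrite gi_orth ?ei_orth.
  exists (a :: s) => [b|/=]; first by rewrite inE => /orP[/eqP->|/sn].
  by rewrite -sE; apply/lfunP => x; rewrite !comp_lfunE reflK.
have nd : onorm (g (e i) - - e i) != 0.
  move/eqP: n0; rewrite onormD onormN opolarNr ngi one_e subr_eq0 => /eqP qge.
  by rewrite opprK onormD ngi one_e -qge -mulr2n -mulr_natr mulf_neq0.
have [|a [na ai az]] := refl_swap _ nd; first by rewrite onormN.
have [||l il|s sn sE] := step (refl (e i) \o refl a)%VF.
- by apply: isom_comp; apply: isom_refl.
- rewrite comp_lfunE ai reflE opolarC opolarNr opolarxx one_e.
  by rewrite mulr1 scaleNr opprK scaler_nat mulr2n addKr.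
- rewrite comp_lfunE az; first by rewrite reflE opolarC ei_orth // scale0r subr0.
  by rewrite gi_orth // opolarC opolarNr opolarC ei_orth // oppr0.
exists (a :: e i :: s) => [b|/=]; first by rewrite !inE => /or3P[/eqP->|/eqP->|/sn].
by rewrite -sE; apply/lfunP => x; rewrite !comp_lfunE !reflK.
Qed.

End CartanDieudonne.

(** * Triality *)

Section TrialityLift.
Variables (F : closedFieldType) (rho : PSO8 F -> PSO8 F).
Local Notation O := (octonion F).
Local Notation one := (oone F).
Hypothesis F2 : 2 != 0 :> F.
Hypothesis rhoP : is_triality rho.

(** The class of [g] is sent by [rho] to that of the second member of a triple
    whose first member is [g]. *)
Definition triality_lift (g : SO8 F) := exists (B : SO8 F) (C : 'End(O)),
  (forall x y, omul (sval g x) (sval B y) = C (omul x y)) /\ rho (pso8 g) = pso8 B.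

Lemma pso8M (g h : SO8 F) : pso8 (g * h)%g = (pso8 g * pso8 h)%g.
Proof. by rewrite [RHS]PSO8_mulE. Qed.

Lemma triality_liftM g h :
  triality_lift g -> triality_lift h -> triality_lift (g * h)%g.
Proof.
move=> [B [C [gC rg]]] [B' [C' [hC rh]]]; exists (B * B')%g, (C \o C')%VF; split.
  by move=> x y; rewrite !comp_lfunE gC hC.
by rewrite !pso8M (trialityM rhoP) rg rh.
Qed.

Lemma pso8_ofE (g : 'End(O)) (gso : g \in @so8 F) : pso8_of g = pso8 (mkSO8 gso).
Proof. by rewrite /pso8_of; congr pso8; apply: val_inj; rewrite val_insubd gso. Qed.

Lemma triality_lift_L a (na : onorm a = 1) : triality_lift (mkSO8 (lmul_so8 F2 na)).
Proof.
exists (mkSO8 (rmul_so8 F2 na)), (lmul a \o rmul a)%VF; split.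
  by move=> x y; rewrite comp_lfunE /= !(lmulE, rmulE) moufang_middle.
by rewrite -!pso8_ofE -[pso8_of _]/(trL a) (trialityL rhoP na).
Qed.

Lemma triality_lift_R a (na : onorm a = 1) : triality_lift (mkSO8 (rmul_so8 F2 na)).
Proof.
have na' : onorm (oconj a) = 1 by rewrite onorm_conj.
pose L (b : O) (nb : onorm b = 1) := mkSO8 (lmul_so8 F2 nb).
pose R (b : O) (nb : onorm b = 1) := mkSO8 (rmul_so8 F2 nb).
have LV : ((L a na)^-1 = L _ na')%g.
  apply: (mulIg (L a na)); rewrite mulVg; apply/val_inj/lfunP => x /=.
  by rewrite comp_lfunE !lmulE omul_conj_mulK na scale1r id_lfunE.
have RV : ((R a na)^-1 = R _ na')%g.
  apply: (mulIg (R a na)); rewrite mulVg; apply/val_inj/lfunP => x /=.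
  by rewrite comp_lfunE !rmulE omul_mul_conjK na scale1r id_lfunE.
exists (L _ na' * R _ na')%g, (rmul (oconj a)); split.
  move=> x y; rewrite comp_lfunE /= !(lmulE, rmulE) -moufang_right.
  by rewrite omul_mul_conjK na scale1r.
rewrite -pso8_ofE -[pso8_of _]/(trR a) (trialityR rhoP na) /trP /trL /trR.
rewrite (pso8_ofE (lmul_so8 F2 na)) (pso8_ofE (rmul_so8 F2 na)) pso8M -LV -RV.
by congr (_ * _)%g; apply: PSO8_invE.
Qed.

(** The reflections are taken in pairs: those in a and b compose to
    L_a R_a R_b' L_b', where b' is the conjugate of b. *)
Lemma triality_lift_even (s : seq O) (g : SO8 F) :
  (forall a, a \in s -> onorm a = 1) -> ~~ odd (size s) ->
  sval g = reflection_prod s -> triality_lift g.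
Proof.
have [n] := ubnP (size s); elim: n s g => // n IH [|a [|b s]] g //=.
  move=> _ _ _ g1; have -> : g = (1 : SO8 F)%g by apply: val_inj.
  exists (1 : SO8 F)%g, \1%VF; split; first by move=> x y; rewrite !id_lfunE.
  have rho1 : rho 1%g = 1%g.
    by apply: (mulgI (rho 1%g)); rewrite -(trialityM rhoP) !mulg1.
  exact: rho1.
rewrite !ltnS negbK => sn abs_n ev gE.
have na : onorm a = 1 by apply: abs_n; rewrite mem_head.
have nb : onorm (oconj b) = 1.
  by rewrite onorm_conj; apply: abs_n; rewrite !inE eqxx orbT.
have s_n c : c \in s -> onorm c = 1 by move=> cs; apply: abs_n; rewrite !inE cs !orbT.
have hso : reflection_prod s \in @so8 F.
  apply/so8P; split; first exact: isom_reflection_prod.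
  by rewrite ldet_reflection_prod // -signr_odd (negPf ev).
have -> : g = (mkSO8 (lmul_so8 F2 na) * (mkSO8 (rmul_so8 F2 na) *
    (mkSO8 (rmul_so8 F2 nb) * (mkSO8 (lmul_so8 F2 nb) * mkSO8 hso))))%g.
  apply/val_inj/lfunP => x; rewrite [val g]gE /= !comp_lfunE !(lmulE, rmulE).
  rewrite !refl_mul //; last by apply: abs_n; rewrite !inE eqxx orbT.
  move: (reflection_prod s x) => y.
  by rewrite oconjN !oconjM oconjK -[omul (- _) a]/(omulr a (- _)) !linearN /= opprK.
by do 4 (apply: triality_liftM; first by
  [exact: triality_lift_L | exact: triality_lift_R]); apply: (IH s) => //; apply: ltnW.
Qed.

Lemma triality_liftP (g : SO8 F) : triality_lift g.
Proof.
have [j jj] := closed_sqrt (-1 : F).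
have /so8P[gq dg] := svalP g.
have [s sn gE] := cartan_dieudonne F2 (orthonormal_expand jj) (orthonormal_polar jj) gq.
apply: (triality_lift_even sn _ gE); move: dg; rewrite gE ldet_reflection_prod // -signr_odd.
case: (odd _) => //= /eqP.
by rewrite expr1 eq_sym -addr_eq0 -mulr2n (negPf F2).
Qed.

(** As g fixes 1, putting x = 1 in g(x) B(y) = C(x y) gives B = C. *)
Lemma triality_spin (g : SO7 F) : exists B : SO8 F,
  (forall x y, omul (sval (sval g) x) (sval B y) = sval B (omul x y)) /\
  rho (pso8 (sval g)) = pso8 B.
Proof.
have [B [C [gC rg]]] := triality_liftP (sval g); exists B; split=> // x y.
rewrite gC -[RHS](omul1o (sval B _)) -(eqP (svalP g)) gC.
by rewrite omul1o.
Qed.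

End TrialityLift.

(** * The isomorphism *)

Lemma module_iso_inverse (F : fieldType) (G : Type) (V W : lmodType F)
    (actV : G -> V -> V) (actW : G -> W -> W) (f : V -> W) :
  linear f -> injective f -> (forall y, exists x, f x = y) ->
  (forall g x, f (actV g x) = actW g (f x)) -> module_iso actW actV.
Proof.
move=> linf injf /choice[h fK] fact.
have linh : linear h by move=> a x y; apply: injf; rewrite fK linf !fK.
exists (HB.pack_for {linear W -> V} h (GRing.isLinear.Build F W V _ h linh)).
split; first by exists f => x /=; [apply: fK | apply: injf; rewrite fK].
by move=> g y /=; apply: injf; rewrite fact !fK.
Qed.

Theorem proposition6p5 (F : closedFieldType) (charF : 2%N \notin [pchar F])
    (rho : PSO8 F -> PSO8 F) (rho_triality : is_triality rho) :
  module_iso (G := SO7 F)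
    (V := sympow 2 (octonion F))
    (W := (extpow 0 (subvs_of (oct0 F)) * extpow 3 (subvs_of (oct0 F)))%type)
    (SO7_twisted_S2 rho)
    (act_sum (@SO7_ext F 0) (@SO7_ext F 3)).
Proof.
have F2 : 2 != 0 :> F by move: charF; rewrite inE /=.
have [j jj] := closed_sqrt (-1 : F).
pose e := tnth (orthonormal_seq j).
have e_expand : forall x, 2 *: x = \sum_i opolar x (e i) *: e i := orthonormal_expand jj.
have e_one : e ord0 = oone F by [].
apply: (module_iso_inverse (f := ext03_sym F2 e_expand)).
- exact: ext03_sym_linear.
- exact: (ext03_sym_inj e_one (orthonormal_polar jj)).
- exact: (ext03_sym_surj F2 e_one e_expand (orthonormal_polar jj)).
move=> g v; have [B [gB rg]] := triality_spin F2 rho_triality g.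
by rewrite /SO7_twisted_S2 rg PSO8_S2E -(ext03_sym_equiv F2 e_expand v (svalP B) gB).
Qed.
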